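(* Let $a>0$, $\gamma\in\mathbb{R}$, $\alpha>0$, and for $x>0$ let $\widetilde f(x,a,\gamma,\alpha)=\sum_{k=0}^{\infty}(-1)^k(k+a)^{\gamma}e^{-(k+a)^{\alpha}x}$. Then $$\widetilde f(x,a,\gamma,\alpha)\underset{x\to+0}{\sim}\sum_{k=0}^{\infty}\frac{(-1)^k}{k!}\,\widetilde\zeta(-\alpha k-\gamma,a)\,x^k .$$ Moreover, if $0<\alpha<1$, then the relation $\sim$ is an equality (with convergent series on the right) for all $x>0$; if $\alpha=1$, then it is an equality for all $x\in(0,\pi)$.
   Context: For fixed $a>0$, $\widetilde\zeta(s,a)$ is defined by $\widetilde\zeta(s,a)=\sum_{k=0}^{\infty}\frac{(-1)^k}{(k+a)^s}$ for $\operatorname{Re}s>0$ and is continued analytically to all of $\mathbb{C}$ (for $\operatorname{Re}s>1$, $\widetilde\zeta(s,a)=\zeta(s,a)-2^{1-s}\zeta\left(s,\frac{a+1}{2}\right)$, where $\zeta(s,a)$ is the Hurwitz zeta function). Meaning of the asymptotic expansion: $F(x)\underset{x\to+0}{\sim}\sum_{k=0}^\infty c_kx^k$ means that for every integer $N\ge0$ one has $F(x)-\sum_{k=0}^{N}c_kx^k=o(x^N)$ as $x\to+0$. *)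

(* Defs.v *)
From Stdlib Require Import Factorial Reals ClassicalEpsilon.
From Coquelicot Require Import Coquelicot.
Open Scope R_scope.

Definition Cexp (z : C) : C :=
  (exp (Re z) * cos (Im z), exp (Re z) * sin (Im z)).

(* Intended for a positive base [t]; [ln] is junk-valued for [t <= 0]. *)
Definition Cpower (t : R) (s : C) : C := Cexp (s * RtoC (ln t))%C.

Definition analytic_at (f : C -> C) (s0 : C) : Prop :=
  exists (c : nat -> C) (r : R), 0 < r /\
    forall s : C, Cmod (s - s0)%C < r ->
      is_pseries (K := C_AbsRing) (V := C_NormedModule) c (s - s0)%C (f s).

Definition is_alt_hurwitz_zeta (a : R) (Z : C -> C) : Prop :=
  (forall s : C, analytic_at Z s) /\
  (forall s : C, 0 < Re s ->
     is_series (K := C_AbsRing) (V := C_NormedModule)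
       (fun k : nat => (RtoC ((-1) ^ k) / Cpower (INR k + a) s)%C) (Z s)).

(* For [0 < a] exactly one function satisfies [is_alt_hurwitz_zeta a]: the
   analytic continuation exists, and is unique by the identity theorem. So the
   choice below is not arbitrary. *)
Definition alt_hurwitz_zeta (a : R) : C -> C :=
  epsilon (inhabits (fun _ : C => RtoC 0)) (is_alt_hurwitz_zeta a).

Definition alt_exp_sum (a gamma alpha x : R) : R :=
  Series (fun k : nat =>
    (-1) ^ k * Rpower (INR k + a) gamma * exp (- Rpower (INR k + a) alpha * x)).

(* Complex coefficients, because [alt_hurwitz_zeta] is complex-valued. *)
Definition asymptotic_expansion_0r (F : R -> C) (c : nat -> C) : Prop :=
  forall N : nat,
    is_domin (Ku := R_AbsRing) (Kv := C_AbsRing)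
      (U := R_NormedModule) (V := C_NormedModule)
      (at_right 0)
      (fun x : R => x ^ N)
      (fun x : R => (F x - sum_n (fun k : nat => c k * RtoC (x ^ k)) N)%C).

Definition zeta_coef (a gamma alpha : R) (k : nat) : C :=
  (RtoC ((-1) ^ k / INR (fact k))
   * alt_hurwitz_zeta a (RtoC (- alpha * INR k - gamma)))%C.

(* Main.v *)
Require Import Defs.
From Stdlib Require Import Factorial ZArith Reals Lra Lia Classical ClassicalEpsilon.
From Coquelicot Require Import Coquelicot.
Open Scope R_scope.

(** The regularised alternating sum [A g a] of [g (k + a)] satisfies
    [A g = (g a - A (fdiff g)) / 2]; iterating this Euler step reduces it to an
    absolutely convergent series as soon as a high difference of [g] is summable.
    Applied to [t^(-s)] it yields the entire continuation of the zeta function,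
    which is unique on the real axis by the identity theorem for power series.
    Applied to [t^gamma exp(-t^alpha x)], whose [m]-th differences are bounded
    uniformly in [x >= 0], it extends the sum to [x = 0] with value
    [zeta(-gamma)]; Taylor's formula in [x] at fixed [t], followed by [A], gives
    the asymptotic expansion.  For [alpha <= 1] the remainder is
    [O(N!^alpha (C x)^N / N!)], hence equality for all [x] if [alpha < 1] and for
    small steps from any base point if [alpha = 1].  In the latter case the series
    converges on [(-PI, PI)] because Boole summation, with the Taylor coefficients
    of [1 / (1 + e^u)], bounds [zeta(-gamma - n)] by [C n! / rho^n] for every
    [rho < PI]; steps of a fixed size then propagate the equality along [(0, PI)]. *)

(** The obstacle is that for gamma >= 0 the series diverges at x = 0, and that each derivative in x
    multiplies the summand by - t^alpha, which makes the divergence worse. So no limit x -> 0 is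
    taken inside a series: a fixed number of Euler steps, chosen for the highest power of t in play,
    is applied for all x >= 0 alike. Bounds uniform in x come from u^j e^(-u) <= j! with u = t^alpha
    x; since x disappears from them, the Taylor remainder is estimated in the same way at every base
    point. Differentiation in x sends gamma to gamma + alpha with a change of sign, so statements
    are proved for all gamma together. For alpha = 1 these estimates lose an exponential factor and
    reach only a short step. The true radius PI is the distance from 0 to the poles of 1 / (1 +
    e^u). It is found by real methods: the coefficients of tanh are majorised by those of tan, whose
    partial sums are compared with tan itself by a differential inequality. *)

(* Coquelicot's structures leave equalities typed in a canonical structure that
   [ring] and [field] do not recognise as [R]. *)
Ltac as_R := match goal with |- @eq _ ?x ?y => change (@eq R x y) end.

(** * Euler transform of alternating sums *)

Definition fdiff (g : R -> R) (t : R) : R := g (t + 1) - g t.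

Fixpoint fdiffn (m : nat) (g : R -> R) : R -> R :=
  match m with O => g | S m => fdiffn m (fdiff g) end.

(** The recursion solves A g + A (g shifted by 1) = g a for A g. The value is meaningful under
    [dsum] at the same order; [Series] of a divergent series is only conventional. *)
Fixpoint asum (m : nat) (g : R -> R) (a : R) : R :=
  match m with
  | O => Series (fun k => (-1) ^ k * g (INR k + a))
  | S m => (g a - asum m (fdiff g) a) / 2
  end.

Definition dsum (m : nat) (g : R -> R) (a : R) : Prop :=
  ex_series (fun k => Rabs (fdiffn m g (INR k + a))).

(** [X i] is meant to dominate the i-th difference; the halvings of [asum] are dropped, which only
    weakens the bound. *)
Fixpoint asum_bound (m : nat) (X : nat -> R -> R) (a : R) : R :=
  match m with
  | O => Series (fun k => X O (INR k + a))
  | S m => X O a + asum_bound m (fun i => X (S i)) a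
  end.

Lemma Rabs_pow_m1 (k : nat) : Rabs ((-1) ^ k) = 1.
Proof. apply pow_1_abs. Qed.

Lemma INR_S_plus (k : nat) (a : R) : INR (S k) + a = INR k + a + 1.
Proof. rewrite S_INR; ring. Qed.

Lemma INR_S_plus' (k : nat) (a : R) : INR k + (a + 1) = INR (S k) + a.
Proof. rewrite S_INR; ring. Qed.

Lemma ex_series_le_R (u v : nat -> R) :
  (forall k, Rabs (u k) <= v k) -> ex_series v -> ex_series u.
Proof. intros H1 H2. apply (@ex_series_le R_AbsRing R_CompleteNormedModule u v); auto. Qed.

Lemma ex_series_scal_R (c : R) (u : nat -> R) :
  ex_series u -> ex_series (fun k => c * u k).
Proof. exact (@ex_series_scal_l R_AbsRing R_NormedModule c u). Qed.

Lemma ex_series_plus_R (u v : nat -> R) :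
  ex_series u -> ex_series v -> ex_series (fun k => u k + v k).
Proof. exact (@ex_series_plus R_AbsRing R_NormedModule u v). Qed.

Lemma ex_series_minus_R (u v : nat -> R) :
  ex_series u -> ex_series v -> ex_series (fun k => u k - v k).
Proof. exact (@ex_series_minus R_AbsRing R_NormedModule u v). Qed.

Lemma ex_series_Rabs_plus (u v : nat -> R) :
  ex_series (fun k => Rabs (u k)) -> ex_series (fun k => Rabs (v k)) ->
  ex_series (fun k => Rabs (u k + v k)).
Proof.
intros Hu Hv. apply ex_series_le_R with (fun k => Rabs (u k) + Rabs (v k)).
- intros k. rewrite Rabs_Rabsolu. apply Rabs_triang.
- exact (ex_series_plus _ _ Hu Hv).
Qed.

Lemma ex_series_Rabs_scal (c : R) (u : nat -> R) :
  ex_series (fun k => Rabs (u k)) -> ex_series (fun k => Rabs (c * u k)).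
Proof.
intros Hu. apply ex_series_ext with (fun k => Rabs c * Rabs (u k)).
- intros k. symmetry. apply Rabs_mult.
- exact (ex_series_scal_l (Rabs c) _ Hu).
Qed.

Lemma ex_series_alt (u : nat -> R) :
  ex_series (fun k => Rabs (u k)) -> ex_series (fun k => (-1) ^ k * u k).
Proof.
intros Hu. apply ex_series_le_R with (2 := Hu).
intros k. rewrite Rabs_mult, Rabs_pow_m1. lra.
Qed.

Lemma fdiffn_ext (m : nat) (g h : R -> R) (t : R) :
  (forall k, g (INR k + t) = h (INR k + t)) -> fdiffn m g t = fdiffn m h t.
Proof.
revert g h. induction m as [|m IH]; intros g h H; simpl.
- generalize (H O); simpl; rewrite Rplus_0_l; auto.
- apply IH. intros k. unfold fdiff. rewrite <- INR_S_plus. now rewrite !H.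
Qed.

Lemma fdiffn_plus (m : nat) (g h : R -> R) (t : R) :
  fdiffn m (fun v => g v + h v) t = fdiffn m g t + fdiffn m h t.
Proof.
revert g h. induction m as [|m IH]; intros g h; simpl; [reflexivity|].
rewrite <- IH. apply fdiffn_ext. intros k. unfold fdiff. ring.
Qed.

Lemma fdiffn_scal (m : nat) (c : R) (g : R -> R) (t : R) :
  fdiffn m (fun v => c * g v) t = c * fdiffn m g t.
Proof.
revert g. induction m as [|m IH]; intros g; simpl; [reflexivity|].
rewrite <- IH. apply fdiffn_ext. intros k. unfold fdiff. ring.
Qed.

Lemma fdiffn_fdiff (m : nat) (g : R -> R) (t : R) :
  fdiffn m (fdiff g) t = fdiffn m g (t + 1) - fdiffn m g t.
Proof.
revert g. induction m as [|m IH]; intros g; simpl; [reflexivity|].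
apply IH.
Qed.

Lemma fdiffn_is_derive (m : nat) (g g' : R -> R) (t : R) :
  0 < t -> (forall v, 0 < v -> is_derive g v (g' v)) ->
  is_derive (fdiffn m g) t (fdiffn m g' t).
Proof.
revert g g'. induction m as [|m IH]; intros g g' Ht H; simpl; [auto|].
apply IH; [exact Ht|]. intros v Hv. unfold fdiff.
apply (is_derive_minus (fun w => g (w + 1)) g); [|now apply H].
evar_last. apply (is_derive_comp g (fun v => v + 1)).
- apply H; lra.
- auto_derive; [auto|reflexivity].
- change (1 * g' (v + 1) = g' (v + 1)). ring.
Qed.

(** A difference is exchanged for a derivative at an unknown point of [t, t + 1]. After m exchanges
    the point may lie anywhere in [t, t + m], hence the windows in the bounds below. *)
Lemma fdiffn_MVT (m : nat) (g g' : R -> R) (t B : R) :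
  0 < t -> (forall v, 0 < v -> is_derive g v (g' v)) ->
  (forall v, t <= v <= t + 1 -> Rabs (fdiffn m g' v) <= B) ->
  Rabs (fdiffn (S m) g t) <= B.
Proof.
intros Ht Hg HB. simpl. rewrite fdiffn_fdiff.
destruct (MVT_gen (fdiffn m g) t (t + 1) (fdiffn m g')) as [c [Hc E]].
- intros x Hx. rewrite Rmin_left, Rmax_right in Hx by lra.
  apply fdiffn_is_derive; [lra|auto].
- intros x Hx. rewrite Rmin_left, Rmax_right in Hx by lra.
  apply derivable_continuous_pt.
  exists (fdiffn m g' x). apply is_derive_Reals.
  apply fdiffn_is_derive; [lra|auto].
- rewrite Rmin_left, Rmax_right in Hc by lra.
  rewrite E. replace (t + 1 - t) with 1 by ring. rewrite Rmult_1_r. now apply HB.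
Qed.

Lemma dsum_S (m : nat) (g : R -> R) (a : R) : dsum m g a -> dsum (S m) g a.
Proof.
unfold dsum. intros H. simpl.
apply ex_series_ext with
  (fun k => Rabs (fdiffn m g (INR (S k) + a) + (- 1) * fdiffn m g (INR k + a))).
- intros k. rewrite fdiffn_fdiff, <- INR_S_plus. f_equal. ring.
- apply ex_series_Rabs_plus.
  + apply (ex_series_incr_1 (fun k => Rabs (fdiffn m g (INR k + a)))), H.
  + now apply ex_series_Rabs_scal.
Qed.

Lemma dsum_le (m n : nat) (g : R -> R) (a : R) :
  (m <= n)%nat -> dsum m g a -> dsum n g a.
Proof. intros H; induction H; intros D; auto using dsum_S. Qed.

Lemma dsum_ext (m : nat) (g h : R -> R) (a : R) :
  (forall k, g (INR k + a) = h (INR k + a)) -> dsum m g a -> dsum m h a.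
Proof.
intros E. apply ex_series_ext. intros k. f_equal. apply fdiffn_ext.
intros j. replace (INR j + (INR k + a)) with (INR (j + k) + a) by (rewrite plus_INR; ring).
apply E.
Qed.

Lemma dsum_plus (m : nat) (g h : R -> R) (a : R) :
  dsum m g a -> dsum m h a -> dsum m (fun v => g v + h v) a.
Proof.
intros Hg Hh. unfold dsum.
apply ex_series_ext with (fun k => Rabs (fdiffn m g (INR k + a) + fdiffn m h (INR k + a))).
- intros k. now rewrite fdiffn_plus.
- now apply ex_series_Rabs_plus.
Qed.

Lemma dsum_scal (m : nat) (c : R) (g : R -> R) (a : R) :
  dsum m g a -> dsum m (fun v => c * g v) a.
Proof.
intros Hg. unfold dsum.
apply ex_series_ext with (fun k => Rabs (c * fdiffn m g (INR k + a))).
- intros k. now rewrite fdiffn_scal.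
- now apply ex_series_Rabs_scal.
Qed.

Lemma dsum_shiftf (m : nat) (g : R -> R) (a : R) :
  dsum m g a -> dsum m (fun v => g (v + 1)) a.
Proof.
intros H. apply (dsum_ext m (fun v => g v + fdiff g v)).
- intros k. unfold fdiff. ring.
- apply dsum_plus; [exact H|]. exact (dsum_S m g a H).
Qed.

Lemma asum_ext (m : nat) (g h : R -> R) (a : R) :
  (forall k, g (INR k + a) = h (INR k + a)) -> asum m g a = asum m h a.
Proof.
revert g h. induction m as [|m IH]; intros g h H; simpl.
- apply Series_ext. intros k. now rewrite H.
- rewrite (IH (fdiff g) (fdiff h)).
  + generalize (H O); simpl; rewrite Rplus_0_l; intros ->; reflexivity.
  + intros k. unfold fdiff. rewrite <- INR_S_plus. now rewrite !H.
Qed.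

Lemma asum_plus (m : nat) (g h : R -> R) (a : R) :
  dsum m g a -> dsum m h a ->
  asum m (fun v => g v + h v) a = asum m g a + asum m h a.
Proof.
revert g h. induction m as [|m IH]; intros g h Hg Hh; simpl.
- rewrite <- Series_plus by now apply ex_series_alt.
  apply Series_ext. intros k. ring.
- rewrite (asum_ext m _ (fun v => fdiff g v + fdiff h v)).
  + rewrite IH by assumption. field.
  + intros k. unfold fdiff. ring.
Qed.

Lemma asum_scal (m : nat) (c : R) (g : R -> R) (a : R) :
  asum m (fun v => c * g v) a = c * asum m g a.
Proof.
revert g. induction m as [|m IH]; intros g; simpl.
- rewrite <- Series_scal_l. apply Series_ext. intros k. ring.
- rewrite (asum_ext m _ (fun v => c * fdiff g v)).
  + rewrite IH. field.
  + intros k. unfold fdiff. ring.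
Qed.

(** For an absolutely convergent series the Euler step is an identity: the alternating sum of
    differences splits into two copies of the series, one without its first term. Higher orders
    reduce to this. *)
Lemma asum_S (m : nat) (g : R -> R) (a : R) :
  dsum m g a -> asum (S m) g a = asum m g a.
Proof.
revert g. induction m as [|m IH]; intros g H.
- simpl. unfold dsum in H; simpl in H.
  rewrite (Series_ext (fun k => (-1) ^ k * fdiff g (INR k + a))
    (fun k => - ((-1) ^ (S k) * g (INR (S k) + a)) + - ((-1) ^ k * g (INR k + a)))).
  2:{ intros k. unfold fdiff. rewrite INR_S_plus. simpl. ring. }
  assert (E : ex_series (fun k => (-1) ^ k * g (INR k + a))) by now apply ex_series_alt.
  rewrite Series_plus.
  + rewrite !Series_opp, (Series_incr_1 (fun k => (-1) ^ k * g (INR k + a))) by exact E.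
    simpl. rewrite Rplus_0_l. field.
  + apply (@ex_series_opp R_AbsRing R_NormedModule). now apply (ex_series_incr_1 (fun k => (-1) ^ k * g (INR k + a))).
  + apply (@ex_series_opp R_AbsRing R_NormedModule). exact E.
- change (asum (S (S m)) g a) with ((g a - asum (S m) (fdiff g) a) / 2).
  rewrite IH by exact H. reflexivity.
Qed.

Lemma asum_le_eq (m n : nat) (g : R -> R) (a : R) :
  (m <= n)%nat -> dsum m g a -> asum n g a = asum m g a.
Proof.
intros H D. induction H as [|n H IH]; [reflexivity|].
rewrite asum_S; [exact IH|]. now apply dsum_le with m.
Qed.

(** The sum started at a + 1 is the tail of the sum started at a with all signs reversed. This
    relation is what Boole summation exploits. *)
Lemma asum_shift (m : nat) (g : R -> R) (a : R) :
  dsum m g a -> asum m g a + asum m g (a + 1) = g a.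
Proof.
revert g. induction m as [|m IH]; intros g H; simpl.
- assert (E : ex_series (fun k => (-1) ^ k * g (INR k + a))) by now apply ex_series_alt.
  rewrite (Series_incr_1 (fun k => (-1) ^ k * g (INR k + a))) by exact E.
  rewrite (Series_ext (fun k => (-1) ^ k * g (INR k + (a + 1)))
     (fun k => - ((-1) ^ S k * g (INR (S k) + a)))).
  + rewrite Series_opp. simpl. rewrite Rplus_0_l. ring.
  + intros k. rewrite INR_S_plus'. simpl. ring.
- generalize (IH (fdiff g) H). unfold fdiff at 3. lra.
Qed.

Lemma asum_shiftf (m : nat) (g : R -> R) (a : R) :
  asum m (fun v => g (v + 1)) a = asum m g (a + 1).
Proof.
revert g. induction m as [|m IH]; intros g; simpl.
- apply Series_ext. intros k. now rewrite Rplus_assoc.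
- rewrite <- IH. reflexivity.
Qed.

Lemma asum_abs_le (m : nat) (g : R -> R) (a : R) (X : nat -> R -> R) :
  (forall i k, (i <= m)%nat -> Rabs (fdiffn i g (INR k + a)) <= X i (INR k + a)) ->
  ex_series (fun k => X m (INR k + a)) ->
  Rabs (asum m g a) <= asum_bound m X a.
Proof.
revert g X. induction m as [|m IH]; intros g X H HX; simpl.
- assert (E : ex_series (fun k => Rabs (g (INR k + a)))).
  { apply ex_series_le_R with (2 := HX). intros k. rewrite Rabs_Rabsolu. now apply (H O). }
  eapply Rle_trans.
  + apply Series_Rabs. apply ex_series_ext with (2 := E).
    intros k. rewrite Rabs_mult, Rabs_pow_m1. symmetry. apply Rmult_1_l.
  + apply Series_le; [|exact HX]. intros k. split; [apply Rabs_pos|].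
    rewrite Rabs_mult, Rabs_pow_m1, Rmult_1_l. now apply (H O).
- assert (A : Rabs (asum m (fdiff g) a) <= asum_bound m (fun i => X (S i)) a).
  { apply IH; [|exact HX]. intros i k Hi. apply (H (S i)). lia. }
  assert (B : Rabs (g a) <= X O a).
  { generalize (H O O (Nat.le_0_l _)). simpl. now rewrite Rplus_0_l. }
  unfold Rdiv. rewrite Rabs_mult, (Rabs_right (/ 2)) by lra.
  generalize (Rabs_triang (g a) (- asum m (fdiff g) a)). rewrite Rabs_Ropp.
  unfold Rminus. generalize (Rabs_pos (g a)) (Rabs_pos (asum m (fdiff g) a)). lra.
Qed.

Lemma dsum_of_bound (m : nat) (g : R -> R) (a : R) (X : R -> R) :
  (forall k, Rabs (fdiffn m g (INR k + a)) <= X (INR k + a)) ->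
  ex_series (fun k => X (INR k + a)) -> dsum m g a.
Proof.
intros H. apply ex_series_le_R. intros k. rewrite Rabs_Rabsolu. apply H.
Qed.

Lemma asum_bound_scal (m : nat) (c : R) (X : nat -> R -> R) (a : R) :
  asum_bound m (fun i t => c * X i t) a = c * asum_bound m X a.
Proof.
revert X. induction m as [|m IH]; intros X; simpl.
- apply Series_scal_l.
- rewrite (IH (fun i => X (S i))). ring.
Qed.

Lemma asum_sum (m N : nat) (g : nat -> R -> R) (a : R) :
  (forall j, (j <= N)%nat -> dsum m (g j) a) ->
  dsum m (fun v => sum_f_R0 (fun j => g j v) N) a /\
  asum m (fun v => sum_f_R0 (fun j => g j v) N) a = sum_f_R0 (fun j => asum m (g j) a) N.
Proof.
induction N as [|N IH]; intros H; simpl.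
- split; [|reflexivity]. now apply H.
- destruct IH as [D E]; [intros; apply H; lia|]. split.
  + apply (dsum_plus m (fun v => sum_f_R0 (fun j => g j v) N)); [exact D|]. now apply H.
  + rewrite (asum_plus m (fun v => sum_f_R0 (fun j => g j v) N)), E; auto.
Qed.

(* Abel summation: one Euler step turns a conditionally convergent alternating
   series into an absolutely convergent one. *)
Lemma asum_1_is_series (g : R -> R) (a : R) :
  dsum 1 g a -> is_lim_seq (fun k => g (INR k + a)) 0 ->
  is_series (fun k => (-1) ^ k * g (INR k + a)) (asum 1 g a).
Proof.
intros D L.
assert (P : forall n, / 2 * (g a - sum_f_R0 (fun k => (-1) ^ k * fdiff g (INR k + a)) n
         + (-1) ^ n * g (INR (S n) + a)) = sum_f_R0 (fun k => (-1) ^ k * g (INR k + a)) n).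
{ induction n as [|n IH].
  - unfold fdiff. simpl. rewrite !Rplus_0_l, (Rplus_comm 1 a). field.
  - rewrite !tech5, <- IH. unfold fdiff.
    rewrite <- (INR_S_plus (S n)). simpl pow. field. }
assert (L1 : is_lim_seq (fun n => / 2 * (g a - sum_f_R0 (fun k => (-1) ^ k * fdiff g (INR k + a)) n
         + (-1) ^ n * g (INR (S n) + a)))
   (/ 2 * (g a - Series (fun k => (-1) ^ k * fdiff g (INR k + a)) + 0))).
{ apply (is_lim_seq_scal_l _ (/ 2)
    (g a - Series (fun k => (-1) ^ k * fdiff g (INR k + a)) + 0)).
  apply is_lim_seq_plus'.
  - apply is_lim_seq_minus'; [apply is_lim_seq_const|].
    apply is_lim_seq_ext with (sum_n (fun k => (-1) ^ k * fdiff g (INR k + a))).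
    + intros n. apply sum_n_Reals.
    + apply (Series_correct (fun k => (-1) ^ k * fdiff g (INR k + a))).
      now apply ex_series_alt.
  - apply is_lim_seq_abs_0.
    apply is_lim_seq_ext with (fun n => Rabs (g (INR (S n) + a))).
    + intros n. rewrite Rabs_mult, Rabs_pow_m1. ring.
    + apply (is_lim_seq_incr_1 (fun n => Rabs (g (INR n + a)))).
      exact (proj1 (is_lim_seq_abs_0 _) L). }
replace (asum 1 g a) with
  (/ 2 * (g a - Series (fun k => (-1) ^ k * fdiff g (INR k + a)) + 0))
  by (simpl; field).
apply is_lim_seq_ext with (2 := L1).
intros n. rewrite P. symmetry. apply sum_n_Reals.
Qed.

(** * Error bounds and interchange of summations *)

Lemma is_series_incr_le (u : nat -> R) (l : R) (N : nat) :
  is_series u l -> (forall n, 0 <= u n) -> sum_f_R0 u N <= l.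
Proof.
intros H P. apply sum_incr; [|exact P].
apply is_lim_seq_Reals. apply is_lim_seq_ext with (2 := H).
intros n. apply sum_n_Reals.
Qed.

Lemma sum_ge_last (u : nat -> R) (n : nat) :
  (forall k, 0 <= u k) -> u n <= sum_f_R0 u n.
Proof.
intros P. destruct n as [|n]; [simpl; lra|]. rewrite tech5.
generalize (cond_pos_sum _ n P). lra.
Qed.

Lemma pow_div_fact_le_exp (x : R) (n : nat) : 0 <= x -> x ^ n / INR (fact n) <= exp x.
Proof.
intros Hx.
assert (P : forall k, 0 <= x ^ k / INR (fact k)).
{ intros k. apply Rmult_le_pos; [now apply pow_le|].
  left. apply Rinv_0_lt_compat, INR_fact_lt_0. }
apply Rle_trans with (sum_f_R0 (fun k => x ^ k / INR (fact k)) n).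
- now apply (sum_ge_last (fun k => x ^ k / INR (fact k))).
- apply is_series_incr_le; [|exact P].
  apply (is_series_ext (fun k => scal (pow_n x k) (/ INR (fact k)))).
  + intros k. rewrite pow_n_pow. reflexivity.
  + apply is_exp_Reals.
Qed.

Lemma Series_tail_geom (u : nat -> R) (X q : R) (N : nat) :
  0 <= q < 1 -> (forall j, Rabs (u j) <= X * q ^ j) ->
  Rabs (Series u - sum_f_R0 u N) <= X * (q ^ S N / (1 - q)).
Proof.
intros Hq H.
assert (Eg : ex_series (fun j => X * q ^ j)).
{ apply ex_series_scal_R,  ex_series_geom. rewrite Rabs_right; lra. }
assert (E : ex_series u) by now apply ex_series_le_R with (2 := Eg).
rewrite (Series_incr_n u (S N)) by (lia || exact E). simpl pred.
replace (_ + _ - _) with (Series (fun k => u (S N + k)%nat)) by ring.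
assert (Eg' : ex_series (fun k => X * q ^ (S N + k))).
{ exact (proj1 (ex_series_incr_n (fun j => X * q ^ j) (S N)) Eg). }
eapply Rle_trans; [apply Series_Rabs|].
- apply ex_series_le_R with (2 := Eg'). intros k. rewrite Rabs_Rabsolu. apply H.
- eapply Rle_trans; [apply Series_le; [|exact Eg']|].
  + intros k. split; [apply Rabs_pos|apply H].
  + rewrite (Series_ext _ (fun k => (X * q ^ S N) * q ^ k)).
    * rewrite Series_scal_l, Series_geom by (rewrite Rabs_right; lra).
      right. field. lra.
    * intros k. rewrite pow_add. ring.
Qed.

Lemma Series_sum_f_R0 (e : nat -> nat -> R) (N : nat) :
  (forall j, ex_series (fun k => e k j)) ->
  ex_series (fun k => sum_f_R0 (e k) N) /\
  Series (fun k => sum_f_R0 (e k) N) = sum_f_R0 (fun j => Series (fun k => e k j)) N.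
Proof.
intros H. induction N as [|N [E IH]]; simpl; [split; [apply H|reflexivity]|].
split.
- exact (ex_series_plus_R _ _ E (H (S N))).
- rewrite <- IH. exact (Series_plus _ _ E (H (S N))).
Qed.

Lemma is_series_of_error_loc (u v : nat -> R) (l : R) :
  eventually (fun N => Rabs (l - sum_f_R0 u N) <= v N) -> is_lim_seq v 0 -> is_series u l.
Proof.
intros H L.
assert (L1 : is_lim_seq (fun N => l - sum_f_R0 u N) 0).
{ apply is_lim_seq_abs_0.
  apply is_lim_seq_le_le_loc with (fun _ => 0) v; [|apply is_lim_seq_const|exact L].
  destruct H as [N HN]. exists N. intros n Hn. split; [apply Rabs_pos|auto]. }
change (is_lim_seq (sum_n u) l).
apply is_lim_seq_ext with (fun N => l - (l - sum_f_R0 u N)).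
- intros n. rewrite sum_n_Reals. ring.
- replace (Finite l) with (Finite (l - 0)) by (f_equal; ring).
  apply is_lim_seq_minus'; [apply is_lim_seq_const|exact L1].
Qed.

Lemma is_series_of_error (u v : nat -> R) (l : R) :
  (forall N, Rabs (l - sum_f_R0 u N) <= v N) -> is_lim_seq v 0 -> is_series u l.
Proof. intros H. apply is_series_of_error_loc. exists O. auto. Qed.

Lemma is_lim_seq_geom_scal (c q : R) : 0 <= q < 1 -> is_lim_seq (fun N => c * q ^ N) 0.
Proof.
intros Hq. replace (Finite 0) with (Rbar_mult c 0).
- apply is_lim_seq_scal_l. apply is_lim_seq_geom. rewrite Rabs_right; lra.
- simpl. f_equal. ring.
Qed.

(** The geometric factor bounds the tails of all rows at once, so the partial sums in j converge
    uniformly relative to the summable weight X. *)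
Lemma Series_swap_geom (e : nat -> nat -> R) (X : nat -> R) (q : R) :
  0 <= q < 1 -> (forall k j, Rabs (e k j) <= X k * q ^ j) -> ex_series X ->
  is_series (fun j => Series (fun k => e k j)) (Series (fun k => Series (e k))).
Proof.
intros Hq H HX.
assert (Ecol : forall j, ex_series (fun k => e k j)).
{ intros j. apply ex_series_le_R with (fun k => X k * q ^ j); [intros k; apply H|].
  apply ex_series_scal_r, HX. }
assert (T : forall k N, Rabs (Series (e k) - sum_f_R0 (e k) N) <= X k * (q ^ S N / (1 - q))).
{ intros k N. apply Series_tail_geom; auto. }
assert (Etail : forall N, ex_series (fun k => X k * (q ^ S N / (1 - q)))).
{ intros N. apply ex_series_scal_r, HX. }
assert (Ed : forall N, ex_series (fun k => Series (e k) - sum_f_R0 (e k) N)).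
{ intros N. apply ex_series_le_R with (2 := Etail N). intros k. apply T. }
assert (Erow : ex_series (fun k => Series (e k))).
{ apply ex_series_ext with
   (fun k => (Series (e k) - sum_f_R0 (e k) O) + sum_f_R0 (e k) O).
  - intros k. unfold Rminus. now rewrite Rplus_assoc, Rplus_opp_l, Rplus_0_r.
  - exact (ex_series_plus_R _ _ (Ed O) (proj1 (Series_sum_f_R0 e O Ecol))). }
apply is_series_of_error with (fun N => (Series X * q / (1 - q)) * q ^ N).
- intros N. destruct (Series_sum_f_R0 e N Ecol) as [E1 <-].
  rewrite <- Series_minus by assumption.
  eapply Rle_trans; [apply Series_Rabs|].
  + apply ex_series_le_R with (2 := Etail N). intros k. rewrite Rabs_Rabsolu. apply T.
  + eapply Rle_trans; [apply Series_le; [|exact (Etail N)]|].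
    * intros k. split; [apply Rabs_pos|apply T].
    * rewrite Series_scal_r. right. simpl. field. lra.
- now apply is_lim_seq_geom_scal.
Qed.

(** Unwinding the Euler steps leaves the interchange to the plain double series of m-th differences,
    where absolute bounds are available; the boundary terms only need each row to converge. *)
Lemma asum_swap_geom (m : nat) (e : R -> nat -> R) (a q : R) (X : nat -> R) :
  0 <= q < 1 ->
  (forall k j, Rabs (fdiffn m (fun v => e v j) (INR k + a)) <= X k * q ^ j) ->
  (forall k, ex_series (e (INR k + a))) -> ex_series X ->
  is_series (fun j => asum m (fun v => e v j) a) (asum m (fun v => Series (e v)) a).
Proof.
intros Hq. revert e. induction m as [|m IH]; intros e H He HX.
- simpl. apply is_series_ext with (fun j => Series (fun k => (-1) ^ k * e (INR k + a) j)).
  + intros j. reflexivity.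
  + rewrite (Series_ext _ (fun k => Series (fun j => (-1) ^ k * e (INR k + a) j))).
    * apply Series_swap_geom with X q; auto.
      intros k j. rewrite Rabs_mult, Rabs_pow_m1, Rmult_1_l. apply (H k j).
    * intros k. now rewrite Series_scal_l.
- simpl.
  assert (D : forall k, fdiff (fun v => Series (e v)) (INR k + a) =
     Series (fun j => e (INR k + a + 1) j - e (INR k + a) j)).
  { intros k. unfold fdiff. symmetry. apply Series_minus; [|apply He].
    rewrite <- INR_S_plus. apply He. }
  assert (I : is_series (fun j => asum m (fun v => e (v + 1) j - e v j) a)
     (asum m (fun v => Series (fun j => e (v + 1) j - e v j)) a)).
  { apply (IH (fun v j => e (v + 1) j - e v j)); [exact H| |exact HX].
    intros k. apply ex_series_minus_R; [|apply He].
    rewrite <- INR_S_plus. apply He. }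
  rewrite (asum_ext m (fdiff (fun v => Series (e v)))
    (fun v => Series (fun j => e (v + 1) j - e v j))) by exact D.
  assert (I0 : is_series (e a) (Series (e a))).
  { apply Series_correct. generalize (He O). simpl. now rewrite Rplus_0_l. }
  generalize (is_series_scal_l (/ 2) _ _ (is_series_minus _ _ _ _ I0 I)).
  unfold Rdiv. rewrite Rmult_comm. apply is_series_ext.
  intros j. unfold scal, plus, opp; simpl. unfold mult; simpl. unfold fdiff. ring.
Qed.

(* The real and imaginary parts of the Taylor coefficients of [s |-> t^(-s)]
   are of the form [osc_pow] with [th = 0] and [th = PI / 2]. *)
Definition osc_pow (tau sg th : R) (j : nat) (t : R) : R :=
  exp (- sg * ln t) * cos (tau * ln t + th) * ((- ln t) ^ j / INR (fact j)).

(** The family is closed under differentiation: [sg] goes up by one, a factor i becomes a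
    quarter-turn of [th], and the derivative of the logarithmic factor lowers [j]. *)
Lemma osc_pow_is_derive (tau sg th : R) (j : nat) (t : R) : 0 < t ->
  is_derive (osc_pow tau sg th j) t
    (- sg * osc_pow tau (sg + 1) th j t + tau * osc_pow tau (sg + 1) (th + PI / 2) j t
     - match j with O => 0 | S j => osc_pow tau (sg + 1) th j t end).
Proof.
intros Ht.
assert (El : exp (- (sg + 1) * ln t) = exp (- sg * ln t) * / t).
{ replace (- (sg + 1) * ln t) with (- sg * ln t + - ln t) by ring.
  rewrite exp_plus, exp_Ropp, exp_ln by exact Ht. reflexivity. }
assert (Ec : cos (tau * ln t + (th + PI / 2)) = - sin (tau * ln t + th)).
{ rewrite <- Rplus_assoc. rewrite (cos_plus _ (PI / 2)), cos_PI2, sin_PI2. ring. }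
unfold osc_pow at 1. auto_derive; [repeat split; exact Ht|].
unfold osc_pow. rewrite El, Ec. destruct j as [|j].
- simpl. field. lra.
- rewrite !fact_simpl, !mult_INR. simpl pred. simpl pow.
  assert (INR (S j) <> 0) by (apply not_0_INR; lia).
  generalize (INR_fact_neq_0 j). intros Hf.
  field. repeat split; auto. lra.
Qed.

(** The factor (/ r)^j comes from |ln t|^j / j! <= r^(-j) exp (r |ln t|); it makes expansions in
    powers of s - s0 converge for |s - s0| < r. Each of the m differentiations costs at most |sg| +
    m + |tau| + r. *)
Lemma osc_pow_fdiffn (tau r : R) (m : nat) (sg th : R) (j : nat) (t B : R) :
  0 < r -> 0 < t ->
  (forall v, t <= v <= t + INR m -> exp (- (sg + INR m) * ln v) * exp (r * Rabs (ln v)) <= B) ->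
  Rabs (fdiffn m (osc_pow tau sg th j) t) <=
    (Rabs sg + INR m + Rabs tau + r) ^ m * (B * (/ r) ^ j).
Proof.
intros Hr. assert (Hir : 0 < / r) by now apply Rinv_0_lt_compat.
revert sg th j t. induction m as [|m IH]; intros sg th j t Ht HB.
- simpl. rewrite Rmult_1_l. unfold osc_pow.
  generalize (HB t). simpl (INR 0). rewrite !Rplus_0_r. intros HBt.
  assert (Hb : exp (- sg * ln t) * exp (r * Rabs (ln t)) <= B) by (apply HBt; lra).
  rewrite !Rabs_mult. rewrite (Rabs_right (exp _)) by (left; apply exp_pos).
  assert (Hc : Rabs (cos (tau * ln t + th)) <= 1).
  { apply Rabs_le. apply COS_bound. }
  assert (Hl : Rabs ((- ln t) ^ j / INR (fact j)) <= exp (r * Rabs (ln t)) * (/ r) ^ j).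
  { unfold Rdiv. rewrite Rabs_mult, <- RPow_abs, Rabs_Ropp, Rabs_inv.
    rewrite (Rabs_right (INR _)) by (left; apply INR_fact_lt_0).
    generalize (pow_div_fact_le_exp (r * Rabs (ln t)) j). rewrite Rpow_mult_distr.
    intros Hp.
    apply Rle_trans with ((r ^ j * Rabs (ln t) ^ j / INR (fact j)) * (/ r) ^ j).
    - right. rewrite pow_inv. field. split; [apply pow_nonzero; lra|apply INR_fact_neq_0].
    - apply Rmult_le_compat_r; [apply pow_le; lra|]. apply Hp.
      apply Rmult_le_pos; [lra|apply Rabs_pos]. }
  apply Rle_trans with (exp (- sg * ln t) * 1 * (exp (r * Rabs (ln t)) * (/ r) ^ j)).
  + apply Rmult_le_compat; [|apply Rabs_pos| |exact Hl].
    * apply Rmult_le_pos; [left; apply exp_pos|apply Rabs_pos].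
    * apply Rmult_le_compat_l; [left; apply exp_pos|exact Hc].
  + rewrite Rmult_1_r, <- Rmult_assoc.
    apply Rmult_le_compat_r; [apply pow_le; lra|exact Hb].
- assert (HB0 : 0 <= B).
  { eapply Rle_trans; [|apply (HB t)].
    - left. apply Rmult_lt_0_compat; apply exp_pos.
    - generalize (pos_INR (S m)). lra. }
  eapply fdiffn_MVT; [exact Ht|intros v Hv; now apply osc_pow_is_derive|].
  intros v Hv.
  set (K := Rabs sg + INR (S m) + Rabs tau + r).
  set (K' := Rabs (sg + 1) + INR m + Rabs tau + r).
  assert (HK' : 0 <= K' <= K).
  { unfold K, K'. rewrite S_INR. generalize (Rabs_triang sg 1). rewrite (Rabs_R1).
    generalize (Rabs_pos (sg + 1)) (Rabs_pos tau) (pos_INR m). lra. }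
  assert (Hpow : 0 <= K' ^ m <= K ^ m).
  { split; [apply pow_le|apply pow_incr]; lra. }
  assert (IH' : forall th j, Rabs (fdiffn m (osc_pow tau (sg + 1) th j) v) <=
     K ^ m * (B * (/ r) ^ j)).
  { intros th' j'. eapply Rle_trans; [apply IH|].
    - lra.
    - intros w Hw. replace (sg + 1 + INR m) with (sg + INR (S m)) by (rewrite S_INR; ring).
      apply HB. rewrite S_INR. lra.
    - apply Rmult_le_compat_r; [|apply Hpow].
      apply Rmult_le_pos; [exact HB0|apply pow_le; lra]. }
  set (b := K ^ m * (B * (/ r) ^ j)).
  assert (Hb : 0 <= b).
  { unfold b. apply Rmult_le_pos; [lra|]. apply Rmult_le_pos; [exact HB0|apply pow_le; lra]. }
  (* Lowering j by one costs a factor r; for j = 0 the term is absent and is written as the zero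
     function. *)
  assert (H3 : Rabs (fdiffn m (match j with O => fun _ => 0 | S j => osc_pow tau (sg + 1) th j end) v)
      <= r * b).
  { destruct j as [|j].
    - rewrite (fdiffn_ext m _ (fun v => 0 * 0)) by (intros; ring).
      rewrite (fdiffn_scal m 0 (fun _ => 0)), Rmult_0_l, Rabs_R0.
      apply Rmult_le_pos; lra.
    - eapply Rle_trans; [apply IH'|]. unfold b. simpl. right. field. lra. }
  rewrite (fdiffn_ext m _ (fun v => (- sg * osc_pow tau (sg + 1) th j v +
     tau * osc_pow tau (sg + 1) (th + PI / 2) j v) +
     (-1) * (match j with O => fun _ => 0 | S j => osc_pow tau (sg + 1) th j end) v))
    by (intros k; destruct j; ring).
  rewrite (fdiffn_plus m (fun v => - sg * osc_pow tau (sg + 1) th j v +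
     tau * osc_pow tau (sg + 1) (th + PI / 2) j v)).
  rewrite (fdiffn_plus m (fun v => - sg * osc_pow tau (sg + 1) th j v)).
  rewrite !fdiffn_scal.
  eapply Rle_trans; [apply Rabs_triang|].
  apply Rle_trans with ((Rabs sg * b + Rabs tau * b) + r * b).
  + apply Rplus_le_compat.
    * eapply Rle_trans; [apply Rabs_triang|].
      rewrite !Rabs_mult, Rabs_Ropp.
      apply Rplus_le_compat; (apply Rmult_le_compat_l; [apply Rabs_pos|apply IH']).
    * rewrite Rabs_mult. replace (Rabs (-1)) with 1.
      -- rewrite Rmult_1_l. exact H3.
      -- rewrite Rabs_left; lra.
  + replace (K ^ S m * (B * (/ r) ^ j)) with (K * b) by (unfold b; simpl; ring).
    replace (Rabs sg * b + Rabs tau * b + r * b) with ((Rabs sg + Rabs tau + r) * b) by ring.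
    apply Rmult_le_compat_r; [exact Hb|]. unfold K. generalize (pos_INR (S m)). lra.
Qed.

(** * Taylor's formula and the complex exponential *)

(** The mean value theorem for g - f and g + f replaces integrating the bound on the derivative. *)
Lemma bounded_increase (f : R -> R) (df : R -> R) (g dg : R -> R) (x y : R) :
  x <= y -> (forall v, x <= v <= y -> is_derive f v (df v)) ->
  (forall v, x <= v <= y -> is_derive g v (dg v)) ->
  (forall v, x <= v <= y -> Rabs (df v) <= dg v) ->
  Rabs (f y - f x) <= g y - g x.
Proof.
intros Hxy Hf Hg H.
assert (A : forall c, c = 1 \/ c = -1 -> c * (f y - f x) <= g y - g x).
{ intros c Hc.
  destruct (MVT_gen (fun v => g v - c * f v) x y (fun v => dg v - c * df v)) as [w [Hw E]].
  - intros v. rewrite Rmin_left, Rmax_right by lra. intros Hv.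
    apply (is_derive_minus g (fun v => c * f v)); [apply Hg; lra|].
    apply (is_derive_scal f). apply Hf; lra.
  - intros v. rewrite Rmin_left, Rmax_right by lra. intros Hv.
    apply derivable_continuous_pt. exists (dg v - c * df v). apply is_derive_Reals.
    apply (is_derive_minus g (fun v => c * f v)); [apply Hg; lra|].
    apply (is_derive_scal f). apply Hf; lra.
  - rewrite Rmin_left, Rmax_right in Hw by lra.
    assert (0 <= dg w - c * df w).
    { generalize (H w Hw). intros Ha. apply Rabs_le_between in Ha. destruct Hc; subst; lra. }
    assert (0 <= (dg w - c * df w) * (y - x)) by (apply Rmult_le_pos; lra).
    lra. }
apply Rabs_le. generalize (A 1 (or_introl eq_refl)) (A (-1) (or_intror eq_refl)). lra.
Qed.

Lemma is_derive_pow_fact (c : R) (n : nat) (v : R) :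
  is_derive (fun v => c * v ^ S n / INR (fact (S n))) v (c * v ^ n / INR (fact n)).
Proof.
rewrite fact_simpl, mult_INR.
assert (INR (S n) <> 0) by (apply not_0_INR; lia).
generalize (INR_fact_neq_0 n). intros Hf.
apply (is_derive_ext (fun v => c / (INR (S n) * INR (fact n)) * v ^ S n)).
- intros w. as_R. field. auto.
- evar_last.
  + apply (is_derive_scal (fun v => v ^ S n)). apply is_derive_pow, @is_derive_id.
  + unfold one; simpl one. simpl pred. change (Init.Nat.pred (S n)) with n.
    change (c / (INR (S n) * INR (fact n)) * (INR (S n) * 1 * v ^ n) = c * v ^ n / INR (fact n)).
    field. auto.
Qed.

(** Induction on the order: the derivative of the remainder is the remainder of one order less for
    the shifted family, and [bounded_increase] integrates its bound. *)
Lemma taylor_bound_0 (N : nat) (H : nat -> R -> R) (h X : R) :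
  0 <= h ->
  (forall n v, 0 <= v <= h -> is_derive (H n) v (H (S n) v)) ->
  (forall v, 0 <= v <= h -> Rabs (H (S N) v) <= X) ->
  Rabs (H O h - sum_f_R0 (fun k => H k 0 * h ^ k / INR (fact k)) N) <=
    X * h ^ S N / INR (fact (S N)).
Proof.
revert H h. induction N as [|N IH]; intros H h Hh HD HX.
- replace (sum_f_R0 _ 0) with (H O 0) by (simpl; field).
  replace (X * h ^ 1 / INR (fact 1)) with (X * h - X * 0) by (simpl; field).
  apply (bounded_increase (H O) (H 1%nat) (fun v => X * v) (fun _ => X)); auto.
  intros v Hv. auto_derive; [auto|ring].
- assert (E0 : forall u : nat -> R, sum_f_R0 (fun k => u k * 0 ^ k / INR (fact k)) (S N) = u O).
  { intros u. rewrite decomp_sum by lia. simpl pred.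
    rewrite (sum_eq _ (fun _ => 0)).
    - rewrite sum_eq_R0 by auto. simpl. field.
    - intros i _. simpl. unfold Rdiv. ring. }
  set (f := fun v => H O v - sum_f_R0 (fun k => H k 0 * v ^ k / INR (fact k)) (S N)).
  set (g := fun v => X * v ^ S (S N) / INR (fact (S (S N)))).
  replace (H O h - _) with (f h - f 0).
  2:{ unfold f. rewrite (E0 (fun k => H k 0)). ring. }
  replace (X * h ^ _ / _) with (g h - g 0).
  2:{ unfold g. simpl pow. unfold Rdiv. ring. }
  apply bounded_increase with
    (df := fun v => H 1%nat v - sum_f_R0 (fun k => H (S k) 0 * v ^ k / INR (fact k)) N)
    (dg := fun v => X * v ^ S N / INR (fact (S N))); [exact Hh| | |].
  + intros v Hv. unfold f. apply (is_derive_minus (H O)); [now apply HD|].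
    apply (is_derive_ext (fun v => H O 0 + sum_f_R0 (fun k => H (S k) 0 * v ^ S k / INR (fact (S k))) N)).
    { intros w. rewrite (decomp_sum _ (S N)) by lia. simpl pred. f_equal. simpl. field. }
    rewrite <- (Rplus_0_l (sum_f_R0 _ N)).
    apply (is_derive_plus (fun _ => H O 0)); [apply @is_derive_const|].
    clear -v. induction N as [|N IH].
    * simpl. auto_derive; [auto|]. field.
    * apply (is_derive_ext (fun v => sum_f_R0 (fun k => H (S k) 0 * v ^ S k / INR (fact (S k))) N
         + H (S (S N)) 0 * v ^ S (S N) / INR (fact (S (S N))))); [reflexivity|].
      rewrite tech5.
      apply (is_derive_plus (fun v => sum_f_R0 (fun k => H (S k) 0 * v ^ S k / INR (fact (S k))) N)
        (fun v => H (S (S N)) 0 * v ^ S (S N) / INR (fact (S (S N))))); [exact IH|].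
      apply is_derive_pow_fact.
  + intros v Hv. apply is_derive_pow_fact.
  + intros v Hv. apply (IH (fun n => H (S n))); [lra| |].
    * intros n w Hw. apply HD. lra.
    * intros w Hw. apply HX. lra.
Qed.

Lemma taylor_bound (N : nat) (H : nat -> R -> R) (x0 h X : R) :
  0 <= h ->
  (forall n v, x0 <= v <= x0 + h -> is_derive (H n) v (H (S n) v)) ->
  (forall v, x0 <= v <= x0 + h -> Rabs (H (S N) v) <= X) ->
  Rabs (H O (x0 + h) - sum_f_R0 (fun k => H k x0 * h ^ k / INR (fact k)) N) <=
    X * h ^ S N / INR (fact (S N)).
Proof.
intros Hh HD HX.
generalize (taylor_bound_0 N (fun n v => H n (x0 + v)) h X Hh). simpl.
rewrite Rplus_0_r. intros A. apply A.
- intros n v Hv. evar_last.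
  + apply (is_derive_comp (H n) (fun v => x0 + v)); [apply HD; lra|].
    auto_derive; [auto|reflexivity].
  + change (1 * H (S n) (x0 + v) = H (S n) (x0 + v)). ring.
- intros v Hv. apply HX. lra.
Qed.

Lemma pow_div_fact_lim (x : R) : is_lim_seq (fun n => x ^ n / INR (fact n)) 0.
Proof.
apply ex_series_lim_0. exists (exp x).
apply (is_series_ext (fun k => scal (pow_n x k) (/ INR (fact k)))).
- intros k. rewrite pow_n_pow. reflexivity.
- apply is_exp_Reals.
Qed.

Definition cpow (z : C) (n : nat) : C := pow_n (K := C_AbsRing) z n.

Lemma cpow_S (z : C) (n : nat) : cpow z (S n) = (z * cpow z n)%C.
Proof. reflexivity. Qed.

Lemma Cmod_cpow (z : C) (n : nat) : Cmod (cpow z n) = Cmod z ^ n.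
Proof.
induction n as [|n IH]; [apply Cmod_1|].
rewrite cpow_S, Cmod_mult, IH. reflexivity.
Qed.

Lemma Im_le_Cmod (z : C) : Rabs (Im z) <= Cmod z.
Proof. eapply Rle_trans; [|apply Rmax_Cmod]. apply Rmax_r. Qed.

Lemma exp_cos_series (w : C) (th : R) :
  is_series (fun j => (Re (cpow w j) * cos th - Im (cpow w j) * sin th) / INR (fact j))
    (exp (Re w) * cos (Im w + th)).
Proof.
set (u := Re w). set (v := Im w).
(* [H n] is the n-th derivative of Re (e^(w t + i th)), that is Re (w^n e^(w t + i th)); the claim
   is its Taylor series at 0, evaluated at t = 1. *)
set (H := fun n t => exp (u * t) *
  (Re (cpow w n) * cos (v * t + th) - Im (cpow w n) * sin (v * t + th))).
apply is_series_of_error with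
  (fun N => (2 * exp (Rabs u)) * (Cmod w ^ S N / INR (fact (S N)))).
- intros N. generalize (taylor_bound_0 N H 1 (exp (Rabs u) * (2 * Cmod w ^ S N))).
  intros A. eapply Rle_trans; [|eapply Rle_trans; [apply A|]].
  + right. f_equal. unfold H at 1. f_equal.
    * simpl. change (Re (cpow w 0)) with 1. change (Im (cpow w 0)) with 0.
      rewrite !Rmult_1_r, Rmult_0_l, Rmult_1_l, Rminus_0_r. reflexivity.
    * apply sum_eq. intros i _. unfold H. rewrite !Rmult_0_r, exp_0, Rplus_0_l, pow1.
      unfold Rdiv. ring.
  + lra.
  + intros n t _. unfold H. auto_derive; [auto|]. rewrite cpow_S.
    change (Re (w * cpow w n)) with (u * Re (cpow w n) - v * Im (cpow w n)).
    change (Im (w * cpow w n)) with (u * Im (cpow w n) + v * Re (cpow w n)).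
    ring.
  + intros t Ht. unfold H. rewrite Rabs_mult, (Rabs_right (exp _)) by (left; apply exp_pos).
    apply Rmult_le_compat; [left; apply exp_pos|apply Rabs_pos| |].
    * assert (E : u * t <= Rabs u).
      { eapply Rle_trans; [apply Rle_abs|]. rewrite Rabs_mult, (Rabs_right t) by lra.
        generalize (Rabs_pos u). nra. }
      destruct E as [E|E]; [left; now apply exp_increasing|right; now f_equal].
    * rewrite <- Cmod_cpow.
      generalize (re_le_Cmod (cpow w (S N))) (Im_le_Cmod (cpow w (S N))).
      set (P := Re _). set (Q := Im _). intros HP HQ.
      eapply Rle_trans; [apply Rabs_triang|]. rewrite Rabs_Ropp, !Rabs_mult.
      assert (Rabs (cos (v * t + th)) <= 1) by (apply Rabs_le, COS_bound).
      assert (Rabs (sin (v * t + th)) <= 1) by (apply Rabs_le, SIN_bound).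
      generalize (Rabs_pos P) (Rabs_pos Q) (Rabs_pos (cos (v * t + th)))
       (Rabs_pos (sin (v * t + th))). nra.
  + right. rewrite pow1. field. apply INR_fact_neq_0.
- replace (Finite 0) with (Rbar_mult (2 * exp (Rabs u)) 0) by (simpl; f_equal; ring).
  apply (is_lim_seq_scal_l (fun N => Cmod w ^ S N / INR (fact (S N)))).
  apply (is_lim_seq_incr_1 (fun N => Cmod w ^ N / INR (fact N))).
  apply pow_div_fact_lim.
Qed.

(** [osc_pow tau sg th 0 t] is Re (e^(-i th) t^(-s)) with s = sg + i tau, so this is t^(-(s+z)) =
    t^(-s) e^(-z ln t) expanded in z. *)
Lemma osc_pow_series (tau sg th : R) (z : C) (t : R) :
  is_series (fun j => Re (cpow z j) * osc_pow tau sg th j t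
      - Im (cpow z j) * osc_pow tau sg (th + PI / 2) j t)
    (osc_pow (tau + Im z) (sg + Re z) th 0 t).
Proof.
set (L := ln t). set (w := (RtoC (- L) * z)%C).
assert (Hw : forall j, Re (cpow w j) = (- L) ^ j * Re (cpow z j) /\
                       Im (cpow w j) = (- L) ^ j * Im (cpow z j)).
{ induction j as [|j [IH1 IH2]].
  - change (cpow w 0) with (RtoC 1). change (cpow z 0) with (RtoC 1). simpl. lra.
  - rewrite !cpow_S.
    change (Re (w * cpow w j)) with (Re w * Re (cpow w j) - Im w * Im (cpow w j)).
    change (Im (w * cpow w j)) with (Re w * Im (cpow w j) + Im w * Re (cpow w j)).
    change (Re (z * cpow z j)) with (Re z * Re (cpow z j) - Im z * Im (cpow z j)).
    change (Im (z * cpow z j)) with (Re z * Im (cpow z j) + Im z * Re (cpow z j)).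
    rewrite IH1, IH2.
    replace (Re w) with (- L * Re z) by (simpl; unfold Re; ring).
    replace (Im w) with (- L * Im z) by (simpl; unfold Im; ring).
    simpl. split; ring. }
assert (HR : Re w = - L * Re z) by (simpl; unfold Re; ring).
assert (HI : Im w = - L * Im z) by (simpl; unfold Im; ring).
generalize (is_series_scal_l (exp (- sg * L)) _ _ (exp_cos_series w (- (tau * L + th)))).
replace (osc_pow (tau + Im z) (sg + Re z) th 0 t) with
  (scal (exp (- sg * L)) (exp (Re w) * cos (Im w + - (tau * L + th)))).
- apply is_series_ext. intros j. match goal with |- context [scal ?x ?y] => change (scal x y) with (x * y) end.
  destruct (Hw j) as [-> ->]. unfold osc_pow. fold L.
  rewrite <- Rplus_assoc, (cos_plus _ (PI / 2)), cos_PI2, sin_PI2, cos_neg, sin_neg.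
  as_R. unfold Rdiv. ring.
- match goal with |- context [scal ?x ?y] => change (scal x y) with (x * y) end. unfold osc_pow. fold L.
  rewrite HR, HI.
  replace (- L * Im z + - (tau * L + th)) with (- ((tau + Im z) * L + th)) by ring.
  rewrite cos_neg, <- Rmult_assoc, <- exp_plus. simpl.
  replace (- sg * L + - L * Re z) with (- (sg + Re z) * L) by ring. field.
Qed.

(** * The alternating Hurwitz zeta function *)

Lemma Rpower_pos (x p : R) : 0 < Rpower x p.
Proof. apply exp_pos. Qed.

Lemma is_derive_Rpower (p x : R) : 0 < x ->
  is_derive (fun t => Rpower t p) x (p * Rpower x (p - 1)).
Proof. intros Hx. apply is_derive_Reals. now apply derivable_pt_lim_power. Qed.

Lemma Rpower_le_decr (x y p : R) : p <= 0 -> 0 < x <= y -> Rpower y p <= Rpower x p.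
Proof.
intros Hp Hxy. replace p with (- (- p)) by ring. rewrite !(Rpower_Ropp _ (- p)).
apply Rinv_le_contravar; [apply Rpower_pos|]. apply Rle_Rpower_l; lra.
Qed.

Lemma ex_series_bounded_pos (u : nat -> R) (M : R) :
  (forall n, 0 <= u n) -> (forall n, sum_f_R0 u n <= M) -> ex_series u.
Proof.
intros P B. destruct (ex_finite_lim_seq_incr (sum_n u) M) as [l Hl].
- intros n. rewrite sum_Sn. generalize (P (S n)). unfold plus; simpl. lra.
- intros n. rewrite sum_n_Reals. apply B.
- exists l. exact Hl.
Qed.

(* Telescoping comparison with [t^(p+1)]. *)
Lemma ex_series_Rpower (a p : R) : 0 < a -> p < -1 ->
  ex_series (fun k => Rpower (INR k + a) p).
Proof.
intros Ha Hp. apply ex_series_incr_1.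
apply ex_series_bounded_pos with (Rpower a (p + 1) / - (p + 1)).
- intros n. left. apply Rpower_pos.
- assert (S1 : forall k, Rpower (INR (S k) + a) p <=
     (Rpower (INR k + a) (p + 1) - Rpower (INR (S k) + a) (p + 1)) / - (p + 1)).
  { intros k. rewrite INR_S_plus. set (t := INR k + a).
    assert (Ht : 0 < t) by (unfold t; generalize (pos_INR k); lra).
    destruct (MVT_gen (fun t => Rpower t (p + 1)) t (t + 1) (fun t => (p + 1) * Rpower t p))
      as [c [Hc E]].
    - intros v. rewrite Rmin_left, Rmax_right by lra. intros Hv.
      evar_last; [apply is_derive_Rpower; lra|].
      replace (p + 1 - 1) with p by ring. reflexivity.
    - intros v. rewrite Rmin_left, Rmax_right by lra. intros Hv.
      apply derivable_continuous_pt. exists ((p + 1) * Rpower v (p + 1 - 1)).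
      apply derivable_pt_lim_power. lra.
    - rewrite Rmin_left, Rmax_right in Hc by lra.
      replace (_ - _) with ((- (p + 1)) * Rpower c p) by lra.
      replace (_ / _) with (Rpower c p) by (field; lra).
      apply Rpower_le_decr; lra. }
  assert (S2 : forall n, sum_f_R0 (fun k => Rpower (INR (S k) + a) p) n <=
     (Rpower a (p + 1) - Rpower (INR (S n) + a) (p + 1)) / - (p + 1)).
  { induction n as [|n IH].
    - simpl sum_f_R0. generalize (S1 O). simpl (INR 0). now rewrite Rplus_0_l.
    - rewrite tech5. generalize (S1 (S n)). unfold Rdiv in *. lra. }
  intros n. eapply Rle_trans; [apply S2|].
  apply Rmult_le_compat_r; [left; apply Rinv_0_lt_compat; lra|].
  generalize (Rpower_pos (INR (S n) + a) (p + 1)). lra.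
Qed.

Lemma exp_abs_ln_le (a r v : R) : 0 < a -> 0 <= r -> a <= v ->
  exp (r * Rabs (ln v)) <= (1 + Rpower a (- (2 * r))) * Rpower v r.
Proof.
intros Ha Hr Hv. generalize (Rpower_pos v r) (Rpower_pos a (- (2 * r))). intros P1 P2.
destruct (Rle_or_lt 0 (ln v)) as [H|H].
- rewrite Rabs_right by lra. change (exp (r * ln v)) with (Rpower v r). nra.
- rewrite Rabs_left by lra.
  apply Rle_trans with (Rpower v (- (2 * r)) * Rpower v r).
  + unfold Rpower. rewrite <- exp_plus. right. f_equal. ring.
  + apply Rmult_le_compat_r; [lra|].
    assert (Rpower v (- (2 * r)) <= Rpower a (- (2 * r))) by (apply Rpower_le_decr; lra).
    lra.
Qed.

Lemma osc_pow_fdiffn_le (tau r a : R) (m : nat) (sg th : R) (j : nat) (t : R) :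
  0 < r -> 0 < a -> r <= sg + INR m -> a <= t ->
  Rabs (fdiffn m (osc_pow tau sg th j) t) <=
    (Rabs sg + INR m + Rabs tau + r) ^ m * (1 + Rpower a (- (2 * r)))
     * Rpower t (- (sg + INR m - r)) * (/ r) ^ j.
Proof.
intros Hr Ha Hm Ht.
eapply Rle_trans; [apply (osc_pow_fdiffn tau r m sg th j t
   ((1 + Rpower a (- (2 * r))) * Rpower t (- (sg + INR m - r)))); [exact Hr|lra|]|].
- intros v Hv.
  apply Rle_trans with (exp (- (sg + INR m) * ln v) * ((1 + Rpower a (- (2 * r))) * Rpower v r)).
  + apply Rmult_le_compat_l; [left; apply exp_pos|]. apply exp_abs_ln_le; lra.
  + replace (_ * _) with ((1 + Rpower a (- (2 * r))) * Rpower v (- (sg + INR m - r))).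
    * apply Rmult_le_compat_l; [generalize (Rpower_pos a (- (2 * r))); lra|].
      apply Rpower_le_decr; lra.
    * unfold Rpower at 2 4.
      replace (- (sg + INR m - r) * ln v) with (- (sg + INR m) * ln v + r * ln v) by ring.
      rewrite exp_plus. ring.
- right. ring.
Qed.

Lemma INR_plus_ge (k : nat) (a : R) : a <= INR k + a.
Proof. generalize (pos_INR k). lra. Qed.

Lemma dsum_osc_pow (tau a : R) (m : nat) (sg th : R) (j : nat) :
  0 < a -> 1 < sg + INR m -> dsum m (osc_pow tau sg th j) a.
Proof.
(* With this r the exponent - (sg + m - r) equals - (sg + m + 1) / 2, which is below -1. *)
intros Ha Hm. set (r := (sg + INR m - 1) / 2).
assert (Hr : 0 < r) by (unfold r; lra).
apply dsum_of_bound with (fun t => (Rabs sg + INR m + Rabs tau + r) ^ m * (1 + Rpower a (- (2 * r)))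
     * Rpower t (- (sg + INR m - r)) * (/ r) ^ j).
- intros k. apply osc_pow_fdiffn_le; auto; [unfold r; lra|apply INR_plus_ge].
- apply ex_series_scal_r, ex_series_scal_R, ex_series_Rpower; [exact Ha|unfold r; lra].
Qed.

Definition zeta_order (sg : R) : nat := Z.to_nat (up (2 - sg)).

Lemma zeta_order_gt (sg : R) : 1 < sg + INR (zeta_order sg).
Proof.
unfold zeta_order. destruct (archimed (2 - sg)) as [A _].
destruct (Z_lt_le_dec (up (2 - sg)) 0%Z) as [H|H].
- apply IZR_lt in H. generalize (pos_INR (Z.to_nat (up (2 - sg)))). lra.
- rewrite INR_IZR_INZ, Z2Nat.id by exact H. lra.
Qed.

Definition zeta_ext (a : R) (s : C) : C :=
  (asum (zeta_order (Re s)) (osc_pow (Im s) (Re s) 0 0) a,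
   asum (zeta_order (Re s)) (osc_pow (Im s) (Re s) (PI / 2) 0) a).

Lemma asum_osc_pow_indep (a tau sg th : R) (m n j : nat) :
  0 < a -> 1 < sg + INR m -> 1 < sg + INR n ->
  asum m (osc_pow tau sg th j) a = asum n (osc_pow tau sg th j) a.
Proof.
intros Ha Hm Hn.
rewrite <- (asum_le_eq m (max m n)), <- (asum_le_eq n (max m n)); auto using dsum_osc_pow; lia.
Qed.

(** The order used in [zeta_ext] jumps with Re s. Any sufficient order gives the same value, so one
    m can serve a whole disc, as analyticity requires. *)
Lemma zeta_ext_eq (a : R) (s : C) (m : nat) : 0 < a -> 1 < Re s + INR m ->
  zeta_ext a s = (asum m (osc_pow (Im s) (Re s) 0 0) a,
                  asum m (osc_pow (Im s) (Re s) (PI / 2) 0) a).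
Proof.
intros Ha Hm. unfold zeta_ext.
f_equal; apply asum_osc_pow_indep; auto using zeta_order_gt.
Qed.

Lemma is_series_C (u : nat -> C) (l : C) :
  is_series (fun k => Re (u k)) (Re l) -> is_series (fun k => Im (u k)) (Im l) ->
  is_series (K := C_AbsRing) (V := C_NormedModule) u l.
Proof.
intros H1 H2.
assert (E : forall n, sum_n (G := C_NormedModule) u n = (sum_n (fun k => Re (u k)) n, sum_n (fun k => Im (u k)) n)).
{ induction n as [|n IH].
  - rewrite !sum_O. now destruct (u O).
  - rewrite !sum_Sn, IH. reflexivity. }
unfold is_series.
apply (filterlim_ext (fun n => (sum_n (fun k => Re (u k)) n, sum_n (fun k => Im (u k)) n))).
- intros n. symmetry. apply E.
- intros P [eps HP].
  destruct (H1 (ball (Re l) eps)) as [N1 HN1]; [now exists eps|].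
  destruct (H2 (ball (Im l) eps)) as [N2 HN2]; [now exists eps|].
  exists (max N1 N2). intros n Hn. apply HP. split; simpl.
  + apply HN1. lia.
  + apply HN2. lia.
Qed.

Lemma is_series_C_Re (u : nat -> C) (l : C) :
  is_series (K := C_AbsRing) (V := C_NormedModule) u l ->
  is_series (fun k => Re (u k)) (Re l).
Proof.
intros H P [eps HP].
destruct (H (fun z => P (Re z))) as [N HN].
- exists eps. intros z [Hz _]. now apply HP.
- exists N. intros n Hn. generalize (HN n Hn).
  replace (Re (sum_n (G := C_NormedModule) u n)) with (sum_n (fun k => Re (u k)) n); [auto|].
  clear. induction n as [|n IH]; [now rewrite !sum_O|]. now rewrite !sum_Sn, IH.
Qed.

Lemma is_series_C_Im (u : nat -> C) (l : C) :
  is_series (K := C_AbsRing) (V := C_NormedModule) u l ->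
  is_series (fun k => Im (u k)) (Im l).
Proof.
intros H P [eps HP].
destruct (H (fun z => P (Im z))) as [N HN].
- exists eps. intros z [_ Hz]. now apply HP.
- exists N. intros n Hn. generalize (HN n Hn).
  replace (Im (sum_n (G := C_NormedModule) u n)) with (sum_n (fun k => Im (u k)) n); [auto|].
  clear. induction n as [|n IH]; [now rewrite !sum_O|]. now rewrite !sum_Sn, IH.
Qed.

Lemma osc_pow_shift_PI (tau sg th : R) (j : nat) (t : R) :
  osc_pow tau sg (th + PI) j t = - osc_pow tau sg th j t.
Proof. unfold osc_pow. rewrite <- Rplus_assoc, neg_cos. ring. Qed.

Lemma asum_osc_pow_series (a tau sg th : R) (m : nat) (z : C) :
  0 < a -> 2 <= sg + INR m -> Cmod z < / 4 ->
  is_series (fun j => Re (cpow z j) * asum m (osc_pow tau sg th j) a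
      - Im (cpow z j) * asum m (osc_pow tau sg (th + PI / 2) j) a)
    (asum m (osc_pow (tau + Im z) (sg + Re z) th 0) a).
Proof.
intros Ha Hm Hz.
set (e := fun t j => Re (cpow z j) * osc_pow tau sg th j t
      - Im (cpow z j) * osc_pow tau sg (th + PI / 2) j t).
assert (De : forall th j, dsum m (osc_pow tau sg th j) a).
{ intros. apply dsum_osc_pow; lra. }
apply is_series_ext with (fun j => asum m (fun v => e v j) a).
{ intros j. unfold e.
  rewrite (asum_ext m _ (fun v => Re (cpow z j) * osc_pow tau sg th j v +
     (- Im (cpow z j)) * osc_pow tau sg (th + PI / 2) j v)) by (intros; ring).
  rewrite (asum_plus m (fun v => Re (cpow z j) * osc_pow tau sg th j v)
    (fun v => (- Im (cpow z j)) * osc_pow tau sg (th + PI / 2) j v));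
    try (apply dsum_scal, De).
  rewrite !asum_scal. as_R. ring. }
rewrite (asum_ext m _ (fun v => Series (e v))).
2:{ intros k. symmetry. apply is_series_unique, osc_pow_series. }
(* Here r = 1/2 in [osc_pow_fdiffn_le]: the ratio in j is 2 |z| < 1/2, and the exponent of t is -
   (sg + m - 1/2) <= -3/2, hence summable. *)
set (A := (Rabs sg + INR m + Rabs tau + / 2) ^ m * (1 + Rpower a (- (2 * (/ 2))))).
apply asum_swap_geom with (q := 2 * Cmod z)
  (X := fun k => 2 * A * Rpower (INR k + a) (- (sg + INR m - / 2))).
- generalize (Cmod_ge_0 z). lra.
- intros k j. unfold e.
  rewrite (fdiffn_ext m _ (fun v => Re (cpow z j) * osc_pow tau sg th j v +
     (- Im (cpow z j)) * osc_pow tau sg (th + PI / 2) j v)) by (intros; ring).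
  rewrite (fdiffn_plus m (fun v => Re (cpow z j) * osc_pow tau sg th j v)
    (fun v => (- Im (cpow z j)) * osc_pow tau sg (th + PI / 2) j v)), !fdiffn_scal.
  assert (B : forall th, Rabs (fdiffn m (osc_pow tau sg th j) (INR k + a)) <=
     A * Rpower (INR k + a) (- (sg + INR m - / 2)) * (/ / 2) ^ j).
  { intros th'. apply osc_pow_fdiffn_le; try lra. apply INR_plus_ge. }
  rewrite Rinv_inv in B.
  eapply Rle_trans; [apply Rabs_triang|]. rewrite !Rabs_mult, Rabs_Ropp.
  generalize (re_le_Cmod (cpow z j)) (Im_le_Cmod (cpow z j)) (B th) (B (th + PI / 2)).
  rewrite Cmod_cpow, Rpow_mult_distr.
  intros H1 H2 B1 B2.
  assert (C1 := Rmult_le_compat _ _ _ _ (Rabs_pos _) (Rabs_pos _) H1 B1).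
  assert (C2 := Rmult_le_compat _ _ _ _ (Rabs_pos _) (Rabs_pos _) H2 B2).
  lra.
- intros k. eexists. apply osc_pow_series.
- apply ex_series_scal_R, ex_series_Rpower; lra.
Qed.

Lemma zeta_ext_analytic (a : R) (s0 : C) : 0 < a -> analytic_at (zeta_ext a) s0.
Proof.
(* Two additional differences leave room for the whole disc of radius 1/4, on which the order stays
   fixed while Re s varies. *)
intros Ha. set (m := S (S (zeta_order (Re s0)))).
assert (Hm : 3 < Re s0 + INR m).
{ unfold m. rewrite !S_INR. generalize (zeta_order_gt (Re s0)). lra. }
exists (fun j => (asum m (osc_pow (Im s0) (Re s0) 0 j) a,
                  asum m (osc_pow (Im s0) (Re s0) (PI / 2) j) a)).
exists (/ 4). split; [lra|]. intros s Hs.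
set (z := (s - s0)%C) in *.
assert (Hz : Rabs (Re z) < / 4) by (eapply Rle_lt_trans; [apply re_le_Cmod|exact Hs]).
assert (ER : Re s = Re s0 + Re z) by (unfold z, Re; simpl; ring).
assert (EI : Im s = Im s0 + Im z) by (unfold z, Im; simpl; ring).
rewrite (zeta_ext_eq a s m Ha).
2:{ apply Rabs_lt_between in Hz. lra. }
rewrite ER, EI. apply is_series_C.
- generalize (asum_osc_pow_series a (Im s0) (Re s0) 0 m z Ha ltac:(lra) Hs).
  rewrite Rplus_0_l. apply is_series_ext. intros j. reflexivity.
- generalize (asum_osc_pow_series a (Im s0) (Re s0) (PI / 2) m z Ha ltac:(lra) Hs).
  apply is_series_ext. intros j.
  replace (PI / 2 + PI / 2) with (0 + PI) by field.
  rewrite (asum_ext m (osc_pow (Im s0) (Re s0) (0 + PI) j)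
     (fun v => (-1) * osc_pow (Im s0) (Re s0) 0 j v)).
  + rewrite asum_scal. unfold scal; simpl. unfold mult; simpl. unfold Cmult, Im, Re; simpl.
    fold (cpow z j). as_R. ring.
  + intros k. rewrite osc_pow_shift_PI. ring.
Qed.

Lemma Cinv_Cpower (t : R) (s : C) :
  (/ Cpower t s)%C = (osc_pow (Im s) (Re s) 0 0 t, osc_pow (Im s) (Re s) (PI / 2) 0 t).
Proof.
assert (E : (Cpower t s * (osc_pow (Im s) (Re s) 0 0 t, osc_pow (Im s) (Re s) (PI / 2) 0 t))%C = RtoC 1).
{ unfold Cpower, Cexp, osc_pow.
  replace (Re (s * ln t)) with (Re s * ln t) by (unfold Re; simpl; ring).
  replace (Im (s * ln t)) with (Im s * ln t) by (unfold Im; simpl; ring).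
  rewrite Rplus_0_r, cos_plus, cos_PI2, sin_PI2.
  replace (- Re s * ln t) with (- (Re s * ln t)) by ring. rewrite exp_Ropp.
  set (x := exp (Re s * ln t)). assert (x <> 0) by (generalize (exp_pos (Re s * ln t)); unfold x; lra).
  set (y := Im s * ln t). generalize (sin2_cos2 y). unfold Rsqr. intros Hy.
  unfold Cmult, RtoC; simpl. f_equal.
  - transitivity (sin y * sin y + cos y * cos y); [field; auto|exact Hy].
  - field. auto. }
assert (N : Cpower t s <> RtoC 0).
{ intros Z. rewrite Z, Cmult_0_l in E. apply (f_equal fst) in E. simpl in E. lra. }
rewrite <- (Cmult_1_r (/ Cpower t s)%C), <- E, Cmult_assoc, Cinv_l, Cmult_1_l; auto.
Qed.

Lemma zeta_ext_spec (a : R) : 0 < a -> is_alt_hurwitz_zeta a (zeta_ext a).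
Proof.
intros Ha. split; [intros s; now apply zeta_ext_analytic|].
(* For Re s > 0 a single Euler step suffices, and Abel summation identifies its value with the
   conditionally convergent series. *)
intros s Hs. rewrite (zeta_ext_eq a s 1 Ha) by (simpl; lra).
assert (A : forall th, is_series (fun k => (-1) ^ k * osc_pow (Im s) (Re s) th 0 (INR k + a))
   (asum 1 (osc_pow (Im s) (Re s) th 0) a)).
{ intros th. apply asum_1_is_series; [apply dsum_osc_pow; simpl; lra|].
  set (r := Re s / 2).
  assert (Hb : forall k, Rabs (osc_pow (Im s) (Re s) th 0 (INR k + a)) <= exp (- (Re s * ln (INR k + a)))).
  { intros k. unfold osc_pow. simpl. replace (1 / 1) with 1 by field.
    rewrite Rmult_1_r, Rabs_mult, Rabs_right by (left; apply exp_pos).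
    replace (- (Re s * ln (INR k + a))) with (- Re s * ln (INR k + a)) by ring.
    rewrite <- (Rmult_1_r (exp _)) at 2.
    apply Rmult_le_compat_l; [left; apply exp_pos|]. apply Rabs_le, COS_bound. }
  apply is_lim_seq_abs_0.
  apply is_lim_seq_le_le with (fun _ => 0) (fun k => exp (- (Re s * ln (INR k + a)))).
  - intros k. split; [apply Rabs_pos|apply Hb].
  - apply is_lim_seq_const.
  - apply (is_lim_comp_seq (fun y => exp (- y)) _ p_infty).
    + apply (is_lim_comp exp Ropp p_infty 0 m_infty).
      * apply is_lim_exp_m.
      * apply (is_lim_opp (fun y => y) p_infty p_infty), is_lim_id.
      * exists 0. intros y _. discriminate.
    + exists O. intros n _. discriminate.
    + replace p_infty with (Rbar_mult (Re s) p_infty).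
      2:{ simpl. destruct (Rle_dec 0 (Re s)) as [H|H]; [|lra].
          destruct (Rle_lt_or_eq_dec 0 (Re s) H); [reflexivity|lra]. }
      apply is_lim_seq_scal_l.
      apply (is_lim_comp_seq ln _ p_infty).
      * apply is_lim_ln_p.
      * exists O. intros n _. discriminate.
      * apply is_lim_seq_plus with p_infty a; [apply is_lim_seq_INR|apply is_lim_seq_const|reflexivity]. }
assert (E : forall k, (RtoC ((-1) ^ k) / Cpower (INR k + a) s)%C =
   ((-1) ^ k * osc_pow (Im s) (Re s) 0 0 (INR k + a),
    (-1) ^ k * osc_pow (Im s) (Re s) (PI / 2) 0 (INR k + a))).
{ intros k. unfold Cdiv. rewrite Cinv_Cpower. unfold Cmult, RtoC; simpl. f_equal; ring. }
apply is_series_C.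
- apply is_series_ext with (2 := A 0). intros k. now rewrite E.
- apply is_series_ext with (2 := A (PI / 2)). intros k. now rewrite E.
Qed.

(** * Uniqueness of the continuation on the real axis *)

Lemma CV_radius_pos (d : nat -> R) (y : R) :
  ex_pseries d y -> Rbar_le (Rabs y) (CV_radius d).
Proof.
intros H. apply Rbar_not_lt_le. intros L. apply (CV_disk_outside d y L).
apply ex_series_lim_0. destruct H as [l Hl]. exists l.
apply is_series_ext with (2 := Hl). intros n. rewrite pow_n_pow. unfold scal; simpl.
unfold mult; simpl. as_R. ring.
Qed.

(** Continuity at 0 along the points r / 2^(k+1), all of which lie where the sum vanishes. *)
Lemma pseries_zero_head (r : R) (d : nat -> R) : 0 < r ->
  (forall y, 0 < y < r -> is_pseries d y 0) -> d O = 0.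
Proof.
intros Hr H.
assert (C : Rbar_lt (Rabs 0) (CV_radius d)).
{ rewrite Rabs_R0. apply Rbar_lt_le_trans with (Rabs (r / 2)).
  - simpl. rewrite Rabs_right; lra.
  - apply CV_radius_pos. exists 0. apply H. lra. }
generalize (PSeries_continuity d 0 C). intros K.
apply continuity_pt_filterlim in K. rewrite PSeries_0 in K.
assert (L : is_lim_seq (fun k => PSeries d (r * (/ 2) ^ S k)) (d O)).
{ apply (filterlim_comp _ _ _ (fun k => r * (/ 2) ^ S k) (PSeries d) eventually (locally 0)); [|exact K].
  change (is_lim_seq (fun k => r * (/ 2) ^ S k) 0).
  apply (is_lim_seq_incr_1 (fun k => r * (/ 2) ^ k)). apply is_lim_seq_geom_scal. lra. }
assert (L0 : is_lim_seq (fun k => PSeries d (r * (/ 2) ^ S k)) 0).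
{ apply is_lim_seq_ext with (fun _ => 0); [|apply is_lim_seq_const].
  intros k. symmetry. apply is_pseries_unique, H.
  assert (P : 0 < (/ 2) ^ S k) by (apply pow_lt; lra).
  assert (Q : (/ 2) ^ S k < 1) by (apply pow_lt_1_compat; [lra|lia]). nra. }
apply is_lim_seq_unique in L. apply is_lim_seq_unique in L0. rewrite L in L0.
now injection L0.
Qed.

(** Once the constant coefficient is known to be 0, division by y > 0 shifts the coefficients by
    one. *)
Lemma pseries_zero_right (r : R) (d : nat -> R) : 0 < r ->
  (forall y, 0 < y < r -> is_pseries d y 0) -> forall n, d n = 0.
Proof.
intros Hr H n. revert d H. induction n as [|n IH]; intros d H.
- now apply pseries_zero_head with r.
- assert (d0 : d O = 0) by now apply pseries_zero_head with r.
  apply (IH (fun k => d (S k))). intros y Hy.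
  assert (A := fun h => is_pseries_decr_1 d y (/ y) 0 h (H y Hy)).
  change (is_pseries (PS_decr_1 d) y 0). evar_last.
  + apply A. unfold mult, one; simpl. as_R. field. lra.
  + rewrite d0. unfold scal, plus, opp; simpl. unfold mult; simpl. as_R. ring.
Qed.

Lemma pseries_zero_both (r : R) (d : nat -> R) (f : R -> R) : 0 < r ->
  (forall y, Rabs y < r -> is_pseries d y (f y)) ->
  (forall y, 0 < y < r -> f y = 0) -> forall y, Rabs y < r -> f y = 0.
Proof.
intros Hr H Hf y Hy.
assert (d0 : forall n, d n = 0).
{ apply (pseries_zero_right r d Hr). intros z Hz. rewrite <- (Hf z Hz). apply H.
  rewrite Rabs_right; lra. }
rewrite <- (is_pseries_unique _ _ _ (H y Hy)). unfold PSeries.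
rewrite (Series_ext _ (fun _ => 0 * 0)).
- rewrite Series_scal_l. ring.
- intros n. rewrite d0. ring.
Qed.

(** Agreement to the right of x0 kills all coefficients of the difference at x0, which forces
    agreement on its left. At real arguments the complex series splits into real and imaginary
    parts. *)
Lemma analytic_at_diff_zero (f g : C -> C) (x0 : R) :
  analytic_at f (RtoC x0) -> analytic_at g (RtoC x0) ->
  exists r, 0 < r /\
    ((forall x, x0 < x -> f (RtoC x) = g (RtoC x)) ->
     forall x, x0 - r < x -> f (RtoC x) = g (RtoC x)).
Proof.
intros [c [r1 [Hr1 Hc]]] [d [r2 [Hr2 Hd]]].
set (r := Rmin r1 r2). exists r. split; [now apply Rmin_pos|].
intros E x Hx. destruct (Rlt_le_dec x0 x) as [H|H]; [now apply E|].
assert (M : forall y, Rabs y < r -> Cmod (RtoC (x0 + y) - RtoC x0)%C < r).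
{ intros y Hy. rewrite <- RtoC_minus, Cmod_R. now replace (x0 + y - x0) with y by ring. }
assert (HP : forall y, (RtoC (x0 + y) - RtoC x0)%C = RtoC y).
{ intros y. rewrite <- RtoC_minus. f_equal. ring. }
assert (pw : forall y n, cpow (RtoC y) n = RtoC (y ^ n)).
{ intros y n. induction n as [|n IH]; [reflexivity|].
  now rewrite cpow_S, IH, <- RtoC_mult. }
assert (SR : forall c' h r', (forall s, Cmod (s - RtoC x0)%C < r' ->
    is_pseries (K := C_AbsRing) (V := C_NormedModule) c' (s - RtoC x0)%C (h s)) -> r <= r' ->
    forall y, Rabs y < r ->
    is_pseries (fun n => Re (c' n)) y (Re (h (RtoC (x0 + y)))) /\
    is_pseries (fun n => Im (c' n)) y (Im (h (RtoC (x0 + y))))).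
{ intros c' h r' Hh Hr' y Hy.
  assert (Q := Hh (RtoC (x0 + y)) (Rlt_le_trans _ _ _ (M y Hy) Hr')).
  rewrite HP in Q. split.
  - apply is_series_C_Re in Q. apply is_series_ext with (2 := Q). intros n.
    rewrite pow_n_pow. change (Re (cpow (RtoC y) n * c' n)%C = y ^ n * Re (c' n)). rewrite pw.
    change (Re (RtoC (y ^ n) * c' n)%C = y ^ n * Re (c' n)).
    unfold Re; simpl. ring.
  - apply is_series_C_Im in Q. apply is_series_ext with (2 := Q). intros n.
    rewrite pow_n_pow. change (Im (cpow (RtoC y) n * c' n)%C = y ^ n * Im (c' n)). rewrite pw.
    change (Im (RtoC (y ^ n) * c' n)%C = y ^ n * Im (c' n)).
    unfold Im; simpl. ring. }
assert (Hrr : 0 < r) by now apply Rmin_pos.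
assert (Hy : Rabs (x - x0) < r) by (rewrite Rabs_left1; lra).
replace (RtoC x) with (RtoC (x0 + (x - x0))) by (f_equal; ring).
assert (R1 := SR c f r1 Hc (Rmin_l _ _)). assert (R2 := SR d g r2 Hd (Rmin_r _ _)).
assert (Z1 : Re (f (RtoC (x0 + (x - x0)))) - Re (g (RtoC (x0 + (x - x0)))) = 0).
{ apply (pseries_zero_both r (fun n => Re (c n) - Re (d n))
    (fun y => Re (f (RtoC (x0 + y))) - Re (g (RtoC (x0 + y))))); auto.
  - intros y H1. apply (is_pseries_minus (fun n => Re (c n)) (fun n => Re (d n))); [apply R1|apply R2]; auto.
  - intros y H1. rewrite E by lra. ring. }
assert (Z2 : Im (f (RtoC (x0 + (x - x0)))) - Im (g (RtoC (x0 + (x - x0)))) = 0).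
{ apply (pseries_zero_both r (fun n => Im (c n) - Im (d n))
    (fun y => Im (f (RtoC (x0 + y))) - Im (g (RtoC (x0 + y))))); auto.
  - intros y H1. apply (is_pseries_minus (fun n => Im (c n)) (fun n => Im (d n))); [apply R1|apply R2]; auto.
  - intros y H1. rewrite E by lra. ring. }
unfold Re, Im in Z1, Z2. apply injective_projections; lra.
Qed.

(** Real points are enough, because [zeta_coef] evaluates the function only there; the order of the
    real line then replaces a connectedness argument. *)
Lemma is_alt_hurwitz_zeta_unique (a : R) (f g : C -> C) :
  is_alt_hurwitz_zeta a f -> is_alt_hurwitz_zeta a g ->
  forall x : R, f (RtoC x) = g (RtoC x).
Proof.
intros [Af Sf] [Ag Sg] x. apply NNPP. intros Hx.
(* Everything at or to the left of a point of disagreement. It is bounded by 0, as for t > 0 both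
   functions are the sum of the same series; [analytic_at_diff_zero] would push its supremum further
   left. *)
set (E := fun y => exists t, y <= t /\ f (RtoC t) <> g (RtoC t)).
assert (P0 : forall t, 0 < t -> f (RtoC t) = g (RtoC t)).
{ intros t Ht.
  generalize (Sf (RtoC t) Ht) (Sg (RtoC t) Ht). intros F G.
  apply injective_projections.
  - generalize (is_series_C_Re _ _ F) (is_series_C_Re _ _ G). intros F' G'.
    apply is_series_unique in F'. apply is_series_unique in G'. unfold Re in *. congruence.
  - generalize (is_series_C_Im _ _ F) (is_series_C_Im _ _ G). intros F' G'.
    apply is_series_unique in F'. apply is_series_unique in G'. unfold Im in *. congruence. }
destruct (completeness E) as [L [UB LUB]].
- exists 0. intros y [t [Hy Ht]]. destruct (Rle_lt_dec y 0) as [H|H]; [exact H|].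
  elim Ht. apply P0. lra.
- exists x, x. split; [lra|exact Hx].
- destruct (analytic_at_diff_zero f g L (Af _) (Ag _)) as [r [Hr H]].
  assert (HL : forall t, L < t -> f (RtoC t) = g (RtoC t)).
  { intros t Ht. apply NNPP. intros N. assert (E t) by (exists t; split; [lra|exact N]).
    generalize (UB t H0). lra. }
  assert (UB' : is_upper_bound E (L - r)).
  { intros y [t [Hy Ht]]. destruct (Rle_lt_dec t (L - r)) as [H'|H']; [lra|].
    elim Ht. apply (H HL). exact H'. }
  generalize (LUB _ UB'). lra.
Qed.

Lemma alt_hurwitz_zeta_real (a sg : R) (m : nat) : 0 < a -> 1 < sg + INR m ->
  alt_hurwitz_zeta a (RtoC sg) = RtoC (asum m (fun t => Rpower t (- sg)) a).
Proof.
intros Ha Hm.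
(* [epsilon] picks an unknown solution: [zeta_ext] shows that one exists, and uniqueness makes the
   choice harmless at real points. *)
assert (S : is_alt_hurwitz_zeta a (alt_hurwitz_zeta a)).
{ unfold alt_hurwitz_zeta. apply epsilon_spec. exists (zeta_ext a). now apply zeta_ext_spec. }
rewrite (is_alt_hurwitz_zeta_unique a _ _ S (zeta_ext_spec a Ha)).
rewrite (zeta_ext_eq a (RtoC sg) m Ha Hm).
unfold RtoC at 5. f_equal.
- apply asum_ext. intros k. unfold osc_pow, Rpower. simpl. rewrite Rmult_0_l, Rplus_0_r, cos_0. field.
- rewrite (asum_ext m _ (fun v => 0 * 0)).
  + rewrite (asum_scal m 0 (fun _ => 0)). ring.
  + intros k. unfold osc_pow. simpl. rewrite Rmult_0_l, Rplus_0_l, cos_PI2. ring.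
Qed.

(** * The regularised sum as a function of x *)

(** j counts the factors x produced by differentiating the exponential in t. Keeping them visible
    closes the family under differentiation and permits bounds uniform in x. *)
Definition pexp (al x ga : R) (j : nat) (t : R) : R :=
  x ^ j * Rpower t ga * exp (- Rpower t al * x).

Lemma pexp_is_derive (al x ga : R) (j : nat) (t : R) : 0 < t ->
  is_derive (pexp al x ga j) t
    (ga * pexp al x (ga - 1) j t - al * pexp al x (ga + al - 1) (S j) t).
Proof.
intros Ht. unfold pexp.
replace (Rpower t (ga + al - 1)) with (Rpower t ga * Rpower t (al - 1))
  by (rewrite <- Rpower_plus; f_equal; ring).
evar_last.
- apply (is_derive_mult (fun t => x ^ j * Rpower t ga) (fun t => exp (- Rpower t al * x)) t
    (x ^ j * (ga * Rpower t (ga - 1)))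
    ((- (al * Rpower t (al - 1)) * x) * exp (- Rpower t al * x))).
  + apply (is_derive_scal (fun t => Rpower t ga)). now apply is_derive_Rpower.
  + apply (is_derive_comp exp (fun t => - Rpower t al * x)); [apply is_derive_exp|].
    apply (is_derive_ext (fun t => - x * Rpower t al)); [intros w; as_R; ring|].
    replace (- (al * Rpower t (al - 1)) * x) with (- x * (al * Rpower t (al - 1))) by ring.
    apply (is_derive_scal (fun t => Rpower t al)). now apply is_derive_Rpower.
  + intros; apply Rmult_comm.
- unfold plus, mult; simpl. as_R. ring.
Qed.

(* Differentiation in [t] preserves the shape and lowers [ga - al * j] by one. *)
Lemma pexp_fdiffn (al x K : R) (m : nat) (ga : R) (j : nat) (t B : R) :
  0 < al -> 0 <= x -> 0 < t ->
  Rabs (ga - al * INR j) + INR m + 2 * al * (INR j + INR m) <= K ->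
  (forall v, t <= v <= t + INR m -> Rpower v (ga - al * INR j - INR m) <= B) ->
  Rabs (fdiffn m (pexp al x ga j) t) <= INR (fact j) * (K ^ m * B).
Proof.
intros Hal Hx. revert ga j t. induction m as [|m IH]; intros ga j t Ht HK HB.
- simpl. rewrite Rmult_1_l.
  assert (Hp : Rpower t (ga - al * INR j) <= B).
  { generalize (HB t). simpl (INR 0). rewrite Rminus_0_r. intros A. apply A. lra. }
  (* In terms of u = t^al x the function is t^(ga - al j) u^j e^(-u), and u^j e^(-u) <= j!: this is
     where x disappears. *)
  unfold pexp. set (u := Rpower t al * x).
  assert (Hu : 0 <= u) by (apply Rmult_le_pos; [left; apply Rpower_pos|exact Hx]).
  replace (x ^ j * Rpower t ga) with (Rpower t (ga - al * INR j) * u ^ j).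
  2:{ unfold u. rewrite Rpow_mult_distr, <- (Rpower_pow j (Rpower t al)) by apply Rpower_pos.
      rewrite Rpower_mult.
      replace (Rpower t ga) with (Rpower t (ga - al * INR j) * Rpower t (al * INR j)).
      - ring.
      - rewrite <- Rpower_plus. f_equal. ring. }
  replace (- Rpower t al * x) with (- u) by (unfold u; ring). rewrite exp_Ropp.
  rewrite Rabs_right.
  2:{ apply Rle_ge. repeat apply Rmult_le_pos.
      - left; apply Rpower_pos.
      - now apply pow_le.
      - left. apply Rinv_0_lt_compat, exp_pos. }
  generalize (pow_div_fact_le_exp u j Hu). intros Hf.
  assert (Hq : u ^ j / exp u <= INR (fact j)).
  { apply Rle_div_l; [apply exp_pos|]. apply Rle_div_l in Hf; [|apply INR_fact_lt_0]. lra. }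
  replace (_ * _) with (Rpower t (ga - al * INR j) * (u ^ j / exp u)) by (unfold Rdiv; ring).
  rewrite (Rmult_comm (INR _)).
  apply Rmult_le_compat; [left; apply Rpower_pos| |exact Hp|exact Hq].
  apply Rdiv_le_0_compat; [now apply pow_le|apply exp_pos].
- assert (HB0 : 0 <= B).
  { eapply Rle_trans; [left; apply Rpower_pos|apply (HB t)]. generalize (pos_INR (S m)). lra. }
  (* K must bound |ga| + al (j + 1) at every differentiation. Each one moves ga - al j by one,
     lowers m by one and never raises j + m, so the hypothesis on K is inherited. *)
  assert (HK' : Rabs ga + al * INR (S j) <= K).
  { generalize (Rabs_triang (ga - al * INR j) (al * INR j)).
    replace (ga - al * INR j + al * INR j) with ga by ring.
    rewrite (Rabs_right (al * INR j)).
    2:{ apply Rle_ge, Rmult_le_pos; [lra|apply pos_INR]. }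
    rewrite S_INR in *.
    assert (0 <= al * INR j) by (apply Rmult_le_pos; [lra|apply pos_INR]).
    assert (0 <= al * INR m) by (apply Rmult_le_pos; [lra|apply pos_INR]).
    generalize (pos_INR m). lra. }
  assert (HK0 : 0 <= K).
  { assert (0 <= al * INR (S j)) by (apply Rmult_le_pos; [lra|apply pos_INR]).
    generalize (Rabs_pos ga). lra. }
  assert (Hm1 : Rabs (ga - al * INR j - 1) <= Rabs (ga - al * INR j) + 1).
  { unfold Rminus at 1. eapply Rle_trans; [apply Rabs_triang|].
    rewrite Rabs_Ropp, Rabs_R1. lra. }
  assert (Hamj : 0 <= al * INR m) by (apply Rmult_le_pos; [lra|apply pos_INR]).
  eapply fdiffn_MVT; [exact Ht|intros v Hv; now apply pexp_is_derive|].
  intros v Hv.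
  rewrite (fdiffn_ext m _ (fun v => ga * pexp al x (ga - 1) j v +
     (- al) * pexp al x (ga + al - 1) (S j) v)) by (intros k; ring).
  rewrite (fdiffn_plus m (fun v => ga * pexp al x (ga - 1) j v)), !fdiffn_scal.
  assert (I1 : Rabs (fdiffn m (pexp al x (ga - 1) j) v) <= INR (fact j) * (K ^ m * B)).
  { apply IH; [lra| |].
    - replace (ga - 1 - al * INR j) with (ga - al * INR j - 1) by ring.
      rewrite S_INR in HK. lra.
    - intros w Hw. replace (_ - _ - _) with (ga - al * INR j - INR (S m)) by (rewrite S_INR; ring).
      apply HB. rewrite S_INR. lra. }
  assert (I2 : Rabs (fdiffn m (pexp al x (ga + al - 1) (S j)) v) <= INR (fact (S j)) * (K ^ m * B)).
  { apply IH; [lra| |].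
    - replace (ga + al - 1 - al * INR (S j)) with (ga - al * INR j - 1) by (rewrite S_INR; ring).
      rewrite S_INR in *. lra.
    - intros w Hw.
      replace (_ - _ - _) with (ga - al * INR j - INR (S m)) by (rewrite !S_INR; ring).
      apply HB. rewrite S_INR. lra. }
  eapply Rle_trans; [apply Rabs_triang|]. rewrite !Rabs_mult, Rabs_Ropp, (Rabs_right al) by lra.
  set (b := K ^ m * B) in *.
  assert (Hb : 0 <= b) by (apply Rmult_le_pos; [now apply pow_le|exact HB0]).
  apply Rle_trans with (Rabs ga * (INR (fact j) * b) + al * (INR (fact (S j)) * b)).
  + apply Rplus_le_compat; (apply Rmult_le_compat_l; [|assumption]); [apply Rabs_pos|lra].
  + rewrite fact_simpl, mult_INR.
    replace (INR (fact j) * (K ^ S m * B)) with (K * (INR (fact j) * b)) by (unfold b; simpl; ring).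
    replace (_ + _) with ((Rabs ga + al * INR (S j)) * (INR (fact j) * b)) by ring.
    apply Rmult_le_compat_r; [|exact HK'].
    apply Rmult_le_pos; [apply pos_INR|exact Hb].
Qed.

(** Both ends of the window [t, t + i] occur because the sign of p - i is unknown, and a power is
    largest at one of them. *)
Definition pexp_maj (K p : R) (i : nat) (t : R) : R :=
  K ^ i * (Rpower t (p - INR i) + Rpower (t + INR i) (p - INR i)).

Lemma Rpower_le_endpoints (q t s v : R) : 0 < t -> t <= v <= s ->
  Rpower v q <= Rpower t q + Rpower s q.
Proof.
intros Ht Hv. generalize (Rpower_pos t q) (Rpower_pos s q). intros.
destruct (Rle_or_lt 0 q).
- assert (Rpower v q <= Rpower s q) by (apply Rle_Rpower_l; lra). lra.
- assert (Rpower v q <= Rpower t q) by (apply Rpower_le_decr; lra). lra.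
Qed.

Lemma pexp_fdiffn_maj (al x K ga : R) (i : nat) (t : R) :
  0 < al -> 0 <= x -> 0 < t -> Rabs ga + INR i + 2 * al * INR i <= K ->
  Rabs (fdiffn i (pexp al x ga 0) t) <= pexp_maj K ga i t.
Proof.
intros Hal Hx Ht HK. unfold pexp_maj. rewrite <- (Rmult_1_l (K ^ i * _)).
apply (pexp_fdiffn al x K i ga 0); auto.
- simpl (INR 0). rewrite Rmult_0_r, Rminus_0_r, Rplus_0_l. exact HK.
- intros v Hv. simpl (INR 0). rewrite Rmult_0_r, Rminus_0_r.
  apply Rpower_le_endpoints; auto.
Qed.

Lemma ex_series_pexp_maj (K p a : R) (m : nat) : 0 < a -> p + 1 < INR m ->
  ex_series (fun k => pexp_maj K p m (INR k + a)).
Proof.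
intros Ha Hm. unfold pexp_maj. apply ex_series_scal_R, ex_series_plus_R.
- apply ex_series_Rpower; lra.
- apply ex_series_ext with (fun k => Rpower (INR k + (a + INR m)) (p - INR m)).
  + intros k. now rewrite <- Rplus_assoc.
  + apply ex_series_Rpower; [|lra]. generalize (pos_INR m). lra.
Qed.

Lemma INR_plus_pos (k : nat) (a : R) : 0 < a -> 0 < INR k + a.
Proof. generalize (pos_INR k). lra. Qed.

Lemma dsum_pexp (al x ga a : R) (m : nat) : 0 < al -> 0 <= x -> 0 < a ->
  ga + 1 < INR m -> dsum m (pexp al x ga 0) a.
Proof.
intros Hal Hx Ha Hm.
apply dsum_of_bound with (pexp_maj (Rabs ga + INR m + 2 * al * INR m) ga m).
- intros k. apply pexp_fdiffn_maj; auto using INR_plus_pos. lra.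
- now apply ex_series_pexp_maj.
Qed.

(** Exponential decay is traded for power decay: t^ga e^(-t^al x) <= x^(-n) n! t^(ga - al n), with n
    so large that the exponent is below -1. The bound blows up as x -> 0, where differences have to
    take over. *)
Lemma dsum_0_pexp (al x ga a : R) : 0 < al -> 0 < x -> 0 < a -> dsum 0 (pexp al x ga 0) a.
Proof.
intros Hal Hx Ha.
assert (Hn : exists n, ga - al * INR n < -1).
{ destruct (nfloor_ex (Rabs ((ga + 2) / al))) as [j [_ Hj]]; [apply Rabs_pos|].
  exists (S j). assert ((ga + 2) / al < INR (S j)).
  { rewrite S_INR. generalize (Rle_abs ((ga + 2) / al)). lra. }
  apply Rlt_div_l in H; [|exact Hal]. lra. }
destruct Hn as [n Hn].
apply dsum_of_bound with (fun t => (/ x) ^ n * INR (fact n) * Rpower t (ga - al * INR n)).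
- intros k. simpl.
  generalize (pexp_fdiffn al x (Rabs (ga - al * INR n) + 0 + 2 * al * (INR n + 0)) 0 ga n (INR k + a)
    (Rpower (INR k + a) (ga - al * INR n)) Hal ltac:(lra) (INR_plus_pos k a Ha)).
  intros A. assert (B := A (Rle_refl _)). clear A. simpl in B. rewrite Rmult_1_l in B.
  replace (pexp al x ga 0 (INR k + a)) with ((/ x) ^ n * pexp al x ga n (INR k + a)).
  + rewrite Rabs_mult, (Rabs_right ((/ x) ^ n)).
    * rewrite Rmult_assoc. apply Rmult_le_compat_l.
      -- apply pow_le. left. now apply Rinv_0_lt_compat.
      -- apply B. intros v Hv. rewrite Rplus_0_r in Hv. rewrite Rminus_0_r.
         replace v with (INR k + a) by lra. lra.
    * apply Rle_ge, pow_le. left. now apply Rinv_0_lt_compat.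
  + unfold pexp. rewrite pow_inv. simpl (x ^ 0). field. apply pow_nonzero. lra.
- apply ex_series_scal_R, ex_series_Rpower; auto.
Qed.

(* The alternating sum, extended to [x = 0] by regularisation. *)
Definition alt_exp_reg (al a ga x : R) : R :=
  asum (zeta_order (- ga)) (pexp al x ga 0) a.

Lemma alt_exp_reg_eq (al a ga x : R) (m : nat) : 0 < al -> 0 <= x -> 0 < a ->
  ga + 1 < INR m -> alt_exp_reg al a ga x = asum m (pexp al x ga 0) a.
Proof.
intros Hal Hx Ha Hm. unfold alt_exp_reg. set (n := zeta_order (- ga)).
assert (Hn : ga + 1 < INR n) by (generalize (zeta_order_gt (- ga)); fold n; lra).
rewrite <- (asum_le_eq m (max m n)), <- (asum_le_eq n (max m n)); auto using dsum_pexp; lia.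
Qed.

Lemma alt_exp_reg_pos (al a ga x : R) : 0 < al -> 0 < x -> 0 < a ->
  alt_exp_reg al a ga x = alt_exp_sum a ga al x.
Proof.
intros Hal Hx Ha. unfold alt_exp_reg.
rewrite (asum_le_eq 0) by (auto using dsum_0_pexp; lia).
unfold alt_exp_sum. simpl. apply Series_ext. intros k. unfold pexp. simpl. ring.
Qed.

Lemma alt_exp_reg_0 (al a ga : R) : 0 < al -> 0 < a ->
  alt_hurwitz_zeta a (RtoC (- ga)) = RtoC (alt_exp_reg al a ga 0).
Proof.
intros Hal Ha.
rewrite (alt_hurwitz_zeta_real a (- ga) (zeta_order (- ga)) Ha (zeta_order_gt _)).
f_equal. unfold alt_exp_reg. apply asum_ext. intros k. unfold pexp.
rewrite Rmult_0_r, exp_0, Ropp_involutive. simpl. ring.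
Qed.

Lemma fdiffn_is_derive_param (m : nat) (G : R -> R -> R) (G' : R -> R) (x t : R) : 0 < t ->
  (forall v, 0 < v -> is_derive (fun y => G y v) x (G' v)) ->
  is_derive (fun y => fdiffn m (G y) t) x (fdiffn m G' t).
Proof.
intros Ht. revert G G'. induction m as [|m IH]; intros G G' H; simpl; [auto|].
apply (IH (fun y => fdiff (G y))). intros v Hv. unfold fdiff.
apply (is_derive_minus (fun y => G y (v + 1)) (fun y => G y v)); apply H; lra.
Qed.

Lemma fdiffn_sum (m N : nat) (g : nat -> R -> R) (t : R) :
  fdiffn m (fun v => sum_f_R0 (fun j => g j v) N) t = sum_f_R0 (fun j => fdiffn m (g j) t) N.
Proof.
induction N as [|N IH]; simpl; [reflexivity|].
rewrite (fdiffn_plus m (fun v => sum_f_R0 (fun j => g j v) N)), IH. reflexivity.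
Qed.

Lemma pexp_is_derive_x (al ga t x : R) :
  is_derive (fun y => pexp al y ga 0 t) x (- pexp al x (ga + al) 0 t).
Proof. unfold pexp. auto_derive; [auto|]. rewrite Rpower_plus. simpl. ring. Qed.

(** The Taylor remainder in x at fixed t. As d/dx multiplies by - t^al, the k-th derivative has
    exponent ga + al k, and the signs gather in (- h)^k. *)
Definition taylor_rem (al ga x0 h : R) (N : nat) (t : R) : R :=
  pexp al (x0 + h) ga 0 t +
  sum_f_R0 (fun k => (- ((- h) ^ k / INR (fact k))) * pexp al x0 (ga + al * INR k) 0 t) N.

Lemma taylor_rem_fdiffn (al ga x0 h K : R) (N i : nat) (t : R) :
  0 < al -> 0 <= x0 -> 0 <= h -> 0 < t ->
  Rabs (ga + al * INR (S N)) + INR i + 2 * al * INR i <= K ->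
  Rabs (fdiffn i (taylor_rem al ga x0 h N) t) <=
    h ^ S N / INR (fact (S N)) * pexp_maj K (ga + al * INR (S N)) i t.
Proof.
intros Hal Hx0 Hh Ht HK.
(* [H n] is the n-th derivative in x of the i-th difference in t; since the two operations commute,
   Taylor's formula can be applied after differencing. *)
set (H := fun n x => (-1) ^ n * fdiffn i (pexp al x (ga + al * INR n) 0) t).
unfold taylor_rem.
rewrite (fdiffn_plus i (pexp al (x0 + h) ga 0)), fdiffn_sum.
generalize (taylor_bound N H x0 h (pexp_maj K (ga + al * INR (S N)) i t) Hh).
intros A. eapply Rle_trans; [|eapply Rle_trans; [apply A|]].
- right. f_equal. unfold Rminus. f_equal.
  + unfold H. simpl. rewrite Rmult_1_l, Rmult_0_r, Rplus_0_r. reflexivity.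
  + rewrite <- (Rmult_1_l (sum_f_R0 (fun k => H k x0 * _ / _) N)), Ropp_mult_distr_l, scal_sum.
    apply sum_eq. intros k _. rewrite fdiffn_scal. unfold H.
    replace (- h) with (-1 * h) by ring. rewrite Rpow_mult_distr. unfold Rdiv. ring.
- intros n v Hv. unfold H. simpl pow. rewrite (Rmult_comm (-1)), Rmult_assoc.
  apply (is_derive_scal (fun v => fdiffn i (pexp al v (ga + al * INR n) 0) t)).
  rewrite <- fdiffn_scal.
  apply fdiffn_is_derive_param; [exact Ht|]. intros w _.
  evar_last; [apply pexp_is_derive_x|]. rewrite S_INR.
  replace (ga + al * (INR n + 1)) with (ga + al * INR n + al) by ring. as_R. ring.
- intros v Hv. unfold H. rewrite Rabs_mult, Rabs_pow_m1, Rmult_1_l.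
  apply pexp_fdiffn_maj; auto. lra.
- right. unfold Rdiv. ring.
Qed.

(** An order m sufficient for the top exponent ga + al (N + 1) serves all lower ones. The right-hand
    side does not mention x0, which later permits steps of one length from every base point. *)
Lemma alt_exp_reg_taylor (al a ga x0 h K : R) (N m : nat) :
  0 < al -> 0 < a -> 0 <= x0 -> 0 <= h ->
  ga + al * INR (S N) + 1 < INR m ->
  Rabs (ga + al * INR (S N)) + INR m + 2 * al * INR m <= K ->
  Rabs (alt_exp_reg al a ga (x0 + h) -
    sum_f_R0 (fun k => (- h) ^ k / INR (fact k) * alt_exp_reg al a (ga + al * INR k) x0) N) <=
  h ^ S N / INR (fact (S N)) * asum_bound m (pexp_maj K (ga + al * INR (S N))) a.
Proof.
intros Hal Ha Hx0 Hh Hm HK.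
assert (Hk : forall k, (k <= S N)%nat -> ga + al * INR k + 1 < INR m).
{ intros k Hk. eapply Rle_lt_trans; [|exact Hm].
  apply le_INR in Hk. apply Rplus_le_compat_r, Rplus_le_compat_l, Rmult_le_compat_l; lra. }
assert (H0 : ga + 1 < INR m) by (generalize (Hk O ltac:(lia)); simpl; lra).
assert (D : forall k, (k <= N)%nat ->
   dsum m (fun t => (- ((- h) ^ k / INR (fact k))) * pexp al x0 (ga + al * INR k) 0 t) a).
{ intros k HkN. apply dsum_scal, dsum_pexp; auto. }
destruct (asum_sum m N (fun k t => (- ((- h) ^ k / INR (fact k))) * pexp al x0 (ga + al * INR k) 0 t) a D)
  as [D1 E1].
replace (alt_exp_reg al a ga (x0 + h) - _) with (asum m (taylor_rem al ga x0 h N) a).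
- rewrite <- asum_bound_scal. apply asum_abs_le.
  + intros i k Hi. apply taylor_rem_fdiffn; auto using INR_plus_pos.
    apply le_INR in Hi. assert (al * INR i <= al * INR m) by (apply Rmult_le_compat_l; lra). lra.
  + apply ex_series_scal_R, ex_series_pexp_maj; auto.
- unfold taylor_rem. rewrite (asum_plus m (pexp al (x0 + h) ga 0)); auto.
  2:{ apply dsum_pexp; auto. lra. }
  rewrite E1, <- alt_exp_reg_eq by (auto; lra). unfold Rminus. f_equal.
  rewrite <- (Rmult_1_l (sum_f_R0 (fun k => (- h) ^ k / _ * _) N)), Ropp_mult_distr_l, scal_sum.
  apply sum_eq. intros k HkN. rewrite asum_scal, <- alt_exp_reg_eq by (auto; lra). ring.
Qed.

Lemma zeta_coef_eq (a ga al : R) (k : nat) : 0 < a -> 0 < al ->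
  zeta_coef a ga al k =
  RtoC ((-1) ^ k / INR (fact k) * alt_exp_reg al a (ga + al * INR k) 0).
Proof.
intros Ha Hal. unfold zeta_coef.
replace (- al * INR k - ga) with (- (ga + al * INR k)) by ring.
rewrite (alt_exp_reg_0 al) by auto. now rewrite RtoC_mult.
Qed.

Lemma zeta_coef_pow (a ga al x : R) (k : nat) : 0 < a -> 0 < al ->
  (zeta_coef a ga al k * RtoC (x ^ k))%C =
  RtoC ((- x) ^ k / INR (fact k) * alt_exp_reg al a (ga + al * INR k) 0).
Proof.
intros Ha Hal. rewrite zeta_coef_eq by auto. rewrite <- RtoC_mult. f_equal.
replace (- x) with (-1 * x) by ring. rewrite Rpow_mult_distr. unfold Rdiv. ring.
Qed.

Lemma sum_n_RtoC (u : nat -> R) (n : nat) :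
  sum_n (G := C_NormedModule) (fun k => RtoC (u k)) n = RtoC (sum_f_R0 u n).
Proof.
induction n as [|n IH]; [now rewrite sum_O|].
rewrite sum_Sn, IH, tech5, RtoC_plus. reflexivity.
Qed.

Lemma alt_exp_sum_asymptotic (a ga al : R) : 0 < a -> 0 < al ->
  asymptotic_expansion_0r (fun x => RtoC (alt_exp_sum a ga al x)) (zeta_coef a ga al).
Proof.
intros Ha Hal N eps.
destruct (nfloor_ex (Rabs (ga + al * INR (S N)) + 1)) as [m [_ Hm]].
{ generalize (Rabs_pos (ga + al * INR (S N))). lra. }
rewrite <- S_INR in Hm.
set (K := Rabs (ga + al * INR (S N)) + INR (S m) + 2 * al * INR (S m)).
set (B := / INR (fact (S N)) * asum_bound (S m) (pexp_maj K (ga + al * INR (S N))) a).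
assert (Hd : 0 < eps / (Rabs B + 1)).
{ apply Rdiv_lt_0_compat; [apply cond_pos|]. generalize (Rabs_pos B). lra. }
exists (mkposreal _ Hd). intros x Hx Hx0.
change (Rabs (x - 0) < eps / (Rabs B + 1)) in Hx. rewrite Rminus_0_r, Rabs_right in Hx by lra.
rewrite (sum_n_ext _ (fun k => RtoC ((- x) ^ k / INR (fact k) * alt_exp_reg al a (ga + al * INR k) 0)))
  by (intros k; now apply zeta_coef_pow).
rewrite sum_n_RtoC, <- RtoC_minus.
change (Cmod (RtoC (alt_exp_sum a ga al x -
  sum_f_R0 (fun k => (- x) ^ k / INR (fact k) * alt_exp_reg al a (ga + al * INR k) 0) N)) <=
  eps * Rabs (x ^ N)).
rewrite Cmod_R, (Rabs_right (x ^ N)) by (apply Rle_ge, pow_le; lra).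
rewrite <- alt_exp_reg_pos by auto.
generalize (alt_exp_reg_taylor al a ga 0 x K N (S m) Hal Ha (Rle_refl 0)).
rewrite Rplus_0_l. intros T. eapply Rle_trans; [apply T|].
- lra.
- generalize (Rle_abs (ga + al * INR (S N))). lra.
- apply Rle_refl.
- replace (_ * _) with (B * x * x ^ N) by (unfold B, Rdiv; simpl pow; ring).
  apply Rmult_le_compat_r; [apply pow_le; lra|].
  apply Rle_trans with ((Rabs B + 1) * x).
  + apply Rmult_le_compat_r; [lra|]. generalize (Rle_abs B). lra.
  + apply Rlt_div_r in Hx; [lra|]. generalize (Rabs_pos B). lra.
Qed.

(** * Growth of the Taylor remainder for alpha <= 1 *)

Lemma asum_bound_le_lin (m : nat) (X : nat -> R -> R) (a b c : R) :
  (forall i, (i < m)%nat -> X i a <= b) -> Series (fun k => X m (INR k + a)) <= c ->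
  asum_bound m X a <= INR m * b + c.
Proof.
revert X. induction m as [|m IH]; intros X Hb Hc.
- simpl. lra.
- rewrite S_INR. simpl. generalize (IH (fun i => X (S i))). intros A.
  assert (asum_bound m (fun i => X (S i)) a <= INR m * b + c).
  { apply A; [|exact Hc]. intros i Hi. apply Hb. lia. }
  generalize (Hb O ltac:(lia)). lra.
Qed.

Lemma pow_Rpower_le (Y : R) (i n : nat) (q : R) : 1 <= Y -> INR i + q <= INR n ->
  Y ^ i * Rpower Y q <= Y ^ n.
Proof.
intros HY H. rewrite <- !Rpower_pow, <- Rpower_plus by lra. now apply Rle_Rpower.
Qed.

(** The point is that C depends on a alone. Y is at once the constant of [pexp_maj], a bound for the
    bases a + i, and, as m < Y, the price of adding m boundary terms. *)
Lemma asum_bound_pexp_maj (a : R) : 0 < a -> exists C, 0 <= C /\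
  forall (p Y : R) (m : nat), 0 <= p -> p + 2 <= INR m <= p + 3 -> 1 <= Y ->
    INR m + 1 <= Y -> a + INR m <= Y -> asum_bound m (pexp_maj Y p) a <= C * Y ^ S m.
Proof.
intros Ha.
(* As p + 2 <= m <= p + 3, one has p - i > -3 for i < m, and -3 <= p - m <= -2. The powers a^(-3)
   and a^(-1) take care of bases below 1, where negative exponents give large values. *)
set (A := 2 * (1 + Rpower a (-3))).
set (T := Series (fun k => 2 * (1 + Rpower a (-1)) * Rpower (INR k + a) (-2))).
assert (HA : 0 <= A) by (unfold A; generalize (Rpower_pos a (-3)); lra).
assert (ET : ex_series (fun k => 2 * (1 + Rpower a (-1)) * Rpower (INR k + a) (-2))).
{ apply ex_series_scal_R, ex_series_Rpower; lra. }
assert (HT : 0 <= T).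
{ unfold T. rewrite <- (Rmult_0_l (Series (fun _ => 0))), <- Series_scal_l.
  apply Series_le; [|exact ET]. intros k.
  generalize (Rpower_pos a (-1)) (Rpower_pos (INR k + a) (-2)). intros.
  split; [lra|]. rewrite Rmult_0_l. apply Rmult_le_pos; lra. }
exists (A + T). split; [lra|]. intros p Y m Hp Hm HY HmY HaY.
assert (HYm : forall n, 0 <= Y ^ n) by (intros; apply pow_le; lra).
apply Rle_trans with (INR m * (A * Y ^ m) + T * Y ^ m).
- apply asum_bound_le_lin.
  + intros i Hi. unfold pexp_maj. apply lt_INR in Hi.
    destruct (Rle_or_lt 0 (p - INR i)) as [H|H].
    * assert (Hi1 : Y ^ i * Rpower Y (p - INR i) <= Y ^ m) by (apply pow_Rpower_le; lra).
      assert (L1 : Rpower a (p - INR i) <= Rpower Y (p - INR i)).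
      { apply Rle_Rpower_l; [lra|]. generalize (pos_INR m). lra. }
      assert (L2 : Rpower (a + INR i) (p - INR i) <= Rpower Y (p - INR i)).
      { apply Rle_Rpower_l; [lra|]. generalize (pos_INR i). lra. }
      apply Rle_trans with (2 * (Y ^ i * Rpower Y (p - INR i))).
      -- replace (2 * (Y ^ i * Rpower Y (p - INR i))) with
           (Y ^ i * (Rpower Y (p - INR i) + Rpower Y (p - INR i))) by ring.
         apply Rmult_le_compat_l; [apply HYm|lra].
      -- unfold A. generalize (Rpower_pos a (-3)) (HYm m). nra.
    * assert (L2 : Rpower (a + INR i) (p - INR i) <= Rpower a (p - INR i)).
      { apply Rpower_le_decr; [lra|]. generalize (pos_INR i). lra. }
      assert (L3 : Rpower a (p - INR i) <= 1 + Rpower a (-3)).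
      { destruct (Rle_or_lt 1 a).
        - assert (Rpower a (p - INR i) <= Rpower a 0) by (apply Rle_Rpower; lra).
          rewrite Rpower_O in H1 by lra. generalize (Rpower_pos a (-3)). lra.
        - assert (Rpower a (p - INR i) <= Rpower a (-3)).
          { replace (p - INR i) with (- (INR i - p)) by ring.
            replace (-3) with (- (3)) by ring. rewrite !Rpower_Ropp, <- !Rpower_Ropp.
            rewrite <- (Rinv_inv a). unfold Rpower. rewrite (ln_Rinv (/ a)) by (now apply Rinv_0_lt_compat).
            replace (- (INR i - p) * - ln (/ a)) with ((INR i - p) * ln (/ a)) by ring.
            replace (- (3) * - ln (/ a)) with (3 * ln (/ a)) by ring.
            apply (Rle_Rpower (/ a)); [|lra].
            rewrite <- Rinv_1. apply Rinv_le_contravar; lra. }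
          lra. }
      apply Rle_trans with (Y ^ m * A); [|right; ring].
      apply Rmult_le_compat; [apply HYm| |apply Rle_pow; [lra|apply INR_lt in Hi; lia]|unfold A; lra].
      generalize (Rpower_pos a (p - INR i)) (Rpower_pos (a + INR i) (p - INR i)). lra.
  + unfold T. rewrite <- Series_scal_r. apply Series_le; [|now apply ex_series_scal_r].
    intros k. unfold pexp_maj. set (t := INR k + a).
    assert (Ht : a <= t) by (apply INR_plus_ge).
    assert (Q1 := Rpower_pos t (p - INR m)). assert (Q2 := Rpower_pos (t + INR m) (p - INR m)).
    assert (L2 : Rpower (t + INR m) (p - INR m) <= Rpower t (p - INR m)).
    { apply Rpower_le_decr; [lra|]. generalize (pos_INR m). lra. }
    assert (L3 : Rpower t (p - INR m) <= (1 + Rpower a (-1)) * Rpower t (-2)).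
    { replace (p - INR m) with ((p - INR m + 2) + -2) by ring. rewrite Rpower_plus.
      apply Rmult_le_compat_r; [left; apply Rpower_pos|].
      destruct (Rle_or_lt 1 t).
      - assert (Rpower t (p - INR m + 2) <= Rpower t 0) by (apply Rle_Rpower; lra).
        rewrite Rpower_O in H0 by lra. generalize (Rpower_pos a (-1)). lra.
      - assert (Rpower t (p - INR m + 2) <= Rpower t (-1)).
        { rewrite <- (Rinv_inv t). unfold Rpower.
          rewrite (ln_Rinv (/ t)) by (apply Rinv_0_lt_compat; lra).
          replace ((p - INR m + 2) * - ln (/ t)) with ((- (p - INR m + 2)) * ln (/ t)) by ring.
          replace (-1 * - ln (/ t)) with (1 * ln (/ t)) by ring.
          apply (Rle_Rpower (/ t)); [|lra].
          rewrite <- Rinv_1. apply Rinv_le_contravar; lra. }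
        assert (Rpower t (-1) <= Rpower a (-1)) by (apply Rpower_le_decr; lra). lra. }
    split; [apply Rmult_le_pos; [apply HYm|lra]|].
    rewrite (Rmult_comm _ (Y ^ m)). apply Rmult_le_compat_l; [apply HYm|]. lra.
- assert (H1 : INR m * (A * Y ^ m) <= Y * (A * Y ^ m)).
  { apply Rmult_le_compat_r; [apply Rmult_le_pos; auto|lra]. }
  assert (H2 : T * Y ^ m <= T * Y ^ S m).
  { apply Rmult_le_compat_l; [exact HT|]. apply Rle_pow; [lra|lia]. }
  simpl pow in *. lra.
Qed.

(** The product of 4, e and e^4, the losses per step in [pow_shift_le_fact]: 4^n is split off,
    (n+c)^n <= n! e^(n+c), and (4(n+c))^G <= G! e^(4(n+c)). Any finite rate would do. *)
Definition crude_rate : R := 4 * exp 5.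

Lemma pow_shift_le_fact (c : R) (G : nat) : 1 <= c -> exists C, 0 <= C /\ forall n : nat,
  (4 * (INR n + c)) ^ (n + G) <= C * (INR (fact n) * crude_rate ^ n).
Proof.
intros Hc. exists (INR (fact G) * exp (5 * c)). split.
{ apply Rmult_le_pos; [apply pos_INR|left; apply exp_pos]. }
intros n. generalize (pos_INR n). intros Hn.
assert (A1 := pow_div_fact_le_exp (INR n + c) n ltac:(lra)).
assert (A2 := pow_div_fact_le_exp (4 * (INR n + c)) G ltac:(lra)).
apply Rle_div_l in A1; [|apply INR_fact_lt_0]. apply Rle_div_l in A2; [|apply INR_fact_lt_0].
rewrite pow_add, Rpow_mult_distr.
apply Rle_trans with (4 ^ n * (exp (INR n + c) * INR (fact n)) * (exp (4 * (INR n + c)) * INR (fact G))).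
- apply Rmult_le_compat; [| |apply Rmult_le_compat_l|]; auto;
    repeat apply Rmult_le_pos; try apply pow_le; lra.
- right. unfold crude_rate. rewrite Rpow_mult_distr.
  replace (exp 5 ^ n) with (exp (5 * INR n)).
  + replace (exp (5 * c)) with (exp (INR n + c) * exp (4 * (INR n + c)) / exp (5 * INR n)).
    * field. generalize (exp_pos (5 * INR n)). lra.
    * unfold Rdiv. rewrite <- exp_Ropp, <- !exp_plus. f_equal. ring.
  + rewrite <- Rpower_pow by apply exp_pos. unfold Rpower. rewrite ln_exp. f_equal. ring.
Qed.

(** With n = N + 1, the 1 / n! of Taylor's formula meets Y^(m+1), where Y = 4 (n + c) and m + 1
    exceeds al n by a bounded amount. In Y^(al n) = Y^n Y^((al-1) n) the first factor is absorbed by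
    n! and [crude_rate]; the second decays when al < 1. *)
Lemma alt_exp_reg_series_bound (al a ga : R) : 0 < al <= 1 -> 0 < a ->
  exists C c, 0 <= C /\ 1 <= c /\ forall N x0 h, 0 <= x0 -> 0 <= h ->
  0 <= ga + al * INR (S N) ->
  Rabs (alt_exp_reg al a ga (x0 + h) -
    sum_f_R0 (fun k => (- h) ^ k / INR (fact k) * alt_exp_reg al a (ga + al * INR k) x0) N) <=
  C * ((crude_rate * h) * Rpower (4 * (INR (S N) + c)) (al - 1)) ^ S N.
Proof.
intros Hal Ha.
destruct (asum_bound_pexp_maj a Ha) as [C1 [HC1 B1]].
(* A generous choice ensuring 4 p + 9 + a <= Y; since m <= p + 3, this covers the constant p + m + 2
   al m <= p + 3 m that Taylor's formula asks for. *)
set (c := Rabs ga + 13 + a). assert (Hc : 1 <= c) by (unfold c; generalize (Rabs_pos ga); lra).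
(* G + 1 exceeds |ga| + 4, the most by which m + 1 can exceed al n. *)
destruct (nfloor_ex (Rabs ga + 4)) as [G [_ HG]]; [generalize (Rabs_pos ga); lra|].
rewrite <- S_INR in HG.
destruct (pow_shift_le_fact c (S G) Hc) as [C2 [HC2 B2]].
exists (C1 * C2), c. split; [now apply Rmult_le_pos|]. split; [exact Hc|].
intros N x0 h Hx0 Hh Hp. set (n := S N) in *. set (p := ga + al * INR n) in *.
set (Y := 4 * (INR n + c)). generalize (pos_INR n). intros Hn.
destruct (nfloor_ex (p + 2)) as [m0 [Hm1 Hm2]]; [lra|]. set (m := S m0).
assert (Hm : p + 2 <= INR m <= p + 3) by (unfold m; rewrite S_INR; lra).
assert (Haln : al * INR n <= INR n) by nra.
assert (Hga := Rle_abs ga).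
assert (HpY : 4 * p + 9 + a <= Y) by (unfold Y, p, c; lra).
assert (HY1 : 1 <= Y) by lra.
eapply Rle_trans; [apply (alt_exp_reg_taylor al a ga x0 h Y N m); try lra|].
- fold n p. lra.
- fold n p. rewrite Rabs_right by lra. assert (2 * al * INR m <= 2 * INR m) by nra. lra.
- fold n p.
  assert (Q : Y ^ S m <= Y ^ (n + S G) * Rpower Y (al - 1) ^ n).
  { rewrite <- (Rpower_pow n (Rpower _ _)) by apply Rpower_pos.
    rewrite Rpower_mult, <- !Rpower_pow, <- Rpower_plus by lra.
    apply Rle_Rpower; [lra|]. rewrite plus_INR, S_INR. unfold p in *. lra. }
  assert (Z0 : 0 <= h ^ n / INR (fact n)).
  { apply Rdiv_le_0_compat; [now apply pow_le|apply INR_fact_lt_0]. }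
  assert (W0 : 0 <= Rpower Y (al - 1) ^ n) by (apply pow_le; left; apply Rpower_pos).
  apply Rle_trans with (h ^ n / INR (fact n) *
     (C1 * ((C2 * (INR (fact n) * crude_rate ^ n)) * Rpower Y (al - 1) ^ n))).
  + apply Rmult_le_compat_l; [exact Z0|].
    eapply Rle_trans; [apply B1; try lra|].
    apply Rmult_le_compat_l; [exact HC1|]. eapply Rle_trans; [exact Q|].
    apply Rmult_le_compat_r; [exact W0|]. apply B2.
  + right. rewrite !Rpow_mult_distr. field. apply INR_fact_neq_0.
Qed.

Lemma crude_rate_pos : 0 < crude_rate.
Proof. unfold crude_rate. generalize (exp_pos 5). lra. Qed.

Lemma alt_exp_reg_series (al a ga x0 h : R) : 0 < al <= 1 -> 0 < a -> 0 <= x0 -> 0 <= h ->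
  al < 1 \/ crude_rate * h <= / 2 ->
  is_series (fun k => (- h) ^ k / INR (fact k) * alt_exp_reg al a (ga + al * INR k) x0)
    (alt_exp_reg al a ga (x0 + h)).
Proof.
intros Hal Ha Hx0 Hh Hor.
destruct (alt_exp_reg_series_bound al a ga Hal Ha) as [C [c [HC [Hc B]]]].
assert (Hq0 : 0 <= crude_rate * h) by (apply Rmult_le_pos; [left; apply crude_rate_pos|exact Hh]).
assert (Hev : exists N0, forall n, (N0 <= n)%nat ->
   0 <= ga + al * INR (S n) /\ crude_rate * h * Rpower (4 * (INR (S n) + c)) (al - 1) <= / 2).
{ destruct (nfloor_ex (Rabs ga / al)) as [N1 [_ HN1]].
  { apply Rdiv_le_0_compat; [apply Rabs_pos|lra]. }
  (* Solves Y0^(al-1) = 1 / (2 (crude_rate h + 1)) when al < 1, so that the ratio is at most 1/2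
     from Y0 on. For al = 1 the ratio is small because h is. *)
  set (Y0 := Rpower (2 * (crude_rate * h + 1)) (/ (1 - al))).
  destruct (nfloor_ex Y0) as [N2 [_ HN2]]; [left; apply Rpower_pos|].
  exists (max N1 N2). intros n Hn. split.
  - assert (INR N1 <= INR n) by (apply le_INR; lia). rewrite S_INR.
    assert (H1 : Rabs ga / al < INR n + 1) by lra. apply Rlt_div_l in H1; [|lra].
    generalize (Rle_abs (- ga)). rewrite Rabs_Ropp. lra.
  - assert (INR N2 <= INR n) by (apply le_INR; lia).
    assert (HY : Y0 <= 4 * (INR (S n) + c)) by (rewrite S_INR; generalize (pos_INR n); lra).
    destruct Hor as [H1|H1].
    + apply Rle_trans with (crude_rate * h * Rpower Y0 (al - 1)).
      * apply Rmult_le_compat_l; [exact Hq0|]. apply Rpower_le_decr; [lra|].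
        split; [apply Rpower_pos|exact HY].
      * unfold Y0. rewrite Rpower_mult. replace (/ (1 - al) * (al - 1)) with (- (1)) by (field; lra).
        rewrite Rpower_Ropp, Rpower_1 by lra.
        apply Rle_div_l; [lra|]. lra.
    + apply Rle_trans with (crude_rate * h * 1); [|lra].
      apply Rmult_le_compat_l; [exact Hq0|].
      assert (HY1 : 1 <= 4 * (INR (S n) + c)) by (rewrite S_INR; generalize (pos_INR n); lra).
      eapply Rle_trans; [apply (Rle_Rpower _ (al - 1) 0); lra|].
      rewrite Rpower_O; lra. }
destruct Hev as [N0 HN0].
apply is_series_of_error_loc with (fun N => C * (/ 2) ^ S N).
- exists N0. intros n Hn. destruct (HN0 n Hn) as [H1 H2].
  eapply Rle_trans; [apply B; auto|].
  apply Rmult_le_compat_l; [exact HC|]. apply pow_incr. split; [|exact H2].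
  apply Rmult_le_pos; [exact Hq0|left; apply Rpower_pos].
- apply is_lim_seq_ext with (fun n => (C * / 2) * (/ 2) ^ n).
  + intros n. simpl. ring.
  + apply is_lim_seq_geom_scal. lra.
Qed.

(** * Taylor coefficients of 1 / (1 + e^u) *)

Definition quarter (n : nat) : R := match n with O => / 4 | S _ => 0 end.

(* [riccati s] lists the Taylor coefficients of the solution of
   [h' = 1/4 + s h^2], [h 0 = 0]: [tan (u/2) / 2] for [s = 1] and
   [tanh (u/2) / 2] for [s = -1]. *)
Fixpoint riccati_tab (s : R) (n : nat) : nat -> R :=
  match n with
  | O => fun _ => 0
  | S m => fun k => if Nat.leb k m then riccati_tab s m k else
      (quarter m + s * sum_f_R0 (fun i => riccati_tab s m i * riccati_tab s m (m - i)) m) / INR (S m)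
  end.

Definition riccati (s : R) (n : nat) : R := riccati_tab s n n.

(** The table encodes a course-of-values recursion: stage n + 1 keeps the entries up to n, so entry
    k is final from stage k on. *)
Lemma riccati_tab_stable (s : R) (n k : nat) : (k <= n)%nat -> riccati_tab s n k = riccati s k.
Proof.
intros H. induction H as [|n H IH]; [reflexivity|].
simpl. destruct (Nat.leb_spec k n); [exact IH|lia].
Qed.

Lemma riccati_S (s : R) (m : nat) : riccati s (S m) =
  (quarter m + s * sum_f_R0 (fun i => riccati s i * riccati s (m - i)) m) / INR (S m).
Proof.
unfold riccati at 1. cbn [riccati_tab]. destruct (Nat.leb_spec (S m) m); [lia|].
do 3 f_equal. apply sum_eq. intros i Hi. rewrite !riccati_tab_stable by lia. reflexivity.
Qed.

(** Majorant principle: for s = 1 the recursion has only nonnegative terms, and the sign s = -1 can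
    only create cancellation. Thus the singularity of tan (u/2) at PI controls tanh (u/2). *)
Lemma riccati_bound (n : nat) : Rabs (riccati (-1) n) <= riccati 1 n.
Proof.
induction n as [n IH] using lt_wf_ind. destruct n as [|n].
- unfold riccati. simpl. rewrite Rabs_R0. lra.
- rewrite !riccati_S. unfold Rdiv. rewrite Rabs_mult.
  rewrite (Rabs_right (/ INR (S n))).
  2:{ left. apply Rinv_0_lt_compat, lt_0_INR. lia. }
  apply Rmult_le_compat_r; [left; apply Rinv_0_lt_compat, lt_0_INR; lia|].
  eapply Rle_trans; [apply Rabs_triang|]. apply Rplus_le_compat.
  + right. apply Rabs_right. destruct n; simpl; lra.
  + rewrite Rabs_mult, (Rabs_left (-1)) by lra.
    replace (- -1) with 1 by ring. rewrite !Rmult_1_l.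
    eapply Rle_trans; [apply Rsum_abs|]. apply sum_Rle. intros i Hi.
    rewrite Rabs_mult. apply Rmult_le_compat; try apply Rabs_pos; apply IH; lia.
Qed.

Lemma riccati_pos (n : nat) : 0 <= riccati 1 n.
Proof. eapply Rle_trans; [apply Rabs_pos|apply riccati_bound]. Qed.

Lemma sum_triangle (f : nat -> nat -> R) (N : nat) :
  sum_f_R0 (fun i => sum_f_R0 (fun l => f i l) (N - i)) N =
  sum_f_R0 (fun q => sum_f_R0 (fun i => f i (q - i)%nat) q) N.
Proof.
induction N as [|N IH]; [reflexivity|].
rewrite (tech5 (fun q => sum_f_R0 _ q)), <- IH, !tech5.
rewrite Nat.sub_diag. simpl (sum_f_R0 _ 0).
rewrite <- Rplus_assoc. f_equal.
rewrite <- sum_plus. apply sum_eq. intros i Hi.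
replace (S N - i)%nat with (S (N - i)) by lia. apply tech5.
Qed.

Lemma sum_f_R0_le_more (u : nat -> R) (n m : nat) :
  (n <= m)%nat -> (forall k, 0 <= u k) -> sum_f_R0 u n <= sum_f_R0 u m.
Proof.
intros H P. induction H as [|m H IH]; [lra|]. rewrite tech5. generalize (P (S m)). lra.
Qed.

Lemma is_derive_psum (u : nat -> R) (N : nat) (x : R) :
  is_derive (fun x => sum_f_R0 (fun k => u k * x ^ k) (S N)) x
    (sum_f_R0 (fun k => INR (S k) * u (S k) * x ^ k) N).
Proof.
induction N as [|N IH].
- simpl. auto_derive; [auto|]. ring.
- rewrite tech5.
  apply (is_derive_plus (fun x => sum_f_R0 (fun k => u k * x ^ k) (S N))
    (fun x => u (S (S N)) * x ^ S (S N))); [exact IH|].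
  evar_last.
  + apply (is_derive_scal (fun x => x ^ S (S N))). apply is_derive_pow, @is_derive_id.
  + change (u (S (S N)) * (INR (S (S N)) * 1 * x ^ S N) = INR (S (S N)) * u (S (S N)) * x ^ S N).
    ring.
Qed.

(** Truncation turns the differential equation into an inequality: the square of the partial sum
    contains every product of the Cauchy sums, and the additional ones are nonnegative. *)
Lemma riccati_psum_derive (Q : nat) (x : R) : 0 <= x ->
  sum_f_R0 (fun k => INR (S k) * riccati 1 (S k) * x ^ k) Q <=
  / 4 + (sum_f_R0 (fun k => riccati 1 k * x ^ k) (S Q)) ^ 2.
Proof.
intros Hx. set (y := fun k => riccati 1 k * x ^ k).
assert (Hy : forall k, 0 <= y k).
{ intros k. apply Rmult_le_pos; [apply riccati_pos|now apply pow_le]. }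
rewrite (sum_eq _ (fun k => quarter k * x ^ k + sum_f_R0 (fun i => y i * y (k - i)%nat) k)).
- rewrite sum_plus. apply Rplus_le_compat.
  + right. induction Q as [|Q IH]; [simpl; ring|]. rewrite tech5, IH. simpl. ring.
  + rewrite <- (sum_triangle (fun i l => y i * y l)).
    apply Rle_trans with (sum_f_R0 (fun i => y i * sum_f_R0 y (S Q)) Q).
    * apply sum_Rle. intros i Hi.
      rewrite (sum_eq (fun l => y i * y l) (fun l => y l * y i)) by (intros; ring).
      rewrite <- scal_sum. apply Rmult_le_compat_l; [apply Hy|].
      apply sum_f_R0_le_more; [lia|exact Hy].
    * rewrite <- scal_sum. rewrite <- Rsqr_pow2. unfold Rsqr.
      apply Rmult_le_compat_l; [now apply cond_pos_sum|].
      apply sum_f_R0_le_more; [lia|exact Hy].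
- intros k _. rewrite riccati_S.
  rewrite Rmult_1_l. unfold Rdiv.
  rewrite (Rmult_comm _ (/ INR (S k))), <- Rmult_assoc, Rinv_r, Rmult_1_l by (apply not_0_INR; lia).
  rewrite Rmult_plus_distr_r. f_equal.
  rewrite (Rmult_comm _ (x ^ k)), scal_sum. apply sum_eq. intros i Hi. unfold y.
  replace (x ^ k) with (x ^ i * x ^ (k - i)) by (rewrite <- pow_add; f_equal; lia). ring.
Qed.

(** A partial sum y satisfies y' <= 1/4 + y^2, so 2 atan (2 y) grows no faster than x. Convergence
    of the tangent series up to PI is thereby obtained, not presupposed. *)
Lemma riccati_tan (q : nat) (x : R) : 0 <= x < PI ->
  riccati 1 q * x ^ q <= tan (x / 2) / 2.
Proof.
intros Hx.
set (y := fun x => sum_f_R0 (fun k => riccati 1 k * x ^ k) (S q)).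
set (dy := fun x => sum_f_R0 (fun k => INR (S k) * riccati 1 (S k) * x ^ k) q).
assert (Hy0 : y 0 = 0).
{ unfold y. rewrite decomp_sum by lia. simpl pred.
  rewrite (sum_eq _ (fun _ => 0)), sum_eq_R0 by (intros; simpl; ring || auto).
  unfold riccati at 1. simpl. ring. }
assert (A : 2 * atan (2 * y x) <= x).
{ generalize (bounded_increase (fun x => 2 * atan (2 * y x) - x / 2) (fun v => 4 * dy v / (1 + (2 * y v) ^ 2) - / 2)
    (fun x => x / 2) (fun _ => / 2) 0 x (proj1 Hx)).
  intros B. rewrite Hy0, Rmult_0_r, atan_0 in B.
  enough (C : Rabs (2 * atan (2 * y x) - x / 2 - (2 * 0 - 0 / 2)) <= x / 2 - 0 / 2).
  { apply Rabs_le_between in C. lra. }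
  apply B.
  - intros v Hv. apply (is_derive_minus (fun x => 2 * atan (2 * y x)) (fun x => x / 2)).
    + evar_last.
      * apply (is_derive_scal (fun x => atan (2 * y x))).
        apply (is_derive_comp atan (fun x => 2 * y x)).
        -- apply is_derive_atan.
        -- apply (is_derive_scal y). apply is_derive_psum.
      * change (2 * ((2 * dy v) * / (1 + Rsqr (2 * y v))) = 4 * dy v / (1 + (2 * y v) ^ 2)).
        unfold Rsqr. assert (0 < 1 + 2 * y v * (2 * y v)) by nra. field. nra.
    + auto_derive; [auto|]. field.
  - intros v Hv. auto_derive; [auto|]. field.
  - intros v Hv. assert (D := riccati_psum_derive q v ltac:(lra)).
    fold (dy v) in D. fold (y v) in D.
    assert (D0 : 0 <= dy v).
    { apply cond_pos_sum. intros k. repeat apply Rmult_le_pos;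
        [apply pos_INR|apply riccati_pos|apply pow_le; lra]. }
    assert (P : 0 < 1 + (2 * y v) ^ 2) by nra.
    assert (E1 : 4 * dy v / (1 + (2 * y v) ^ 2) <= 1) by (apply Rle_div_l; [exact P|nra]).
    assert (E2 : 0 <= 4 * dy v / (1 + (2 * y v) ^ 2)).
    { apply Rdiv_le_0_compat; [lra|exact P]. }
    apply Rabs_le. lra. }
assert (B : 2 * y x <= tan (x / 2)).
{ rewrite <- (tan_atan (2 * y x)). destruct (Rle_lt_or_eq_dec (atan (2 * y x)) (x / 2)) as [L|L]; [lra| |].
  - left. apply tan_increasing; [|exact L|lra]. generalize (atan_bound (2 * y x)). lra.
  - right. now f_equal. }
assert (E : riccati 1 q * x ^ q <= y x).
{ assert (P : forall k, 0 <= riccati 1 k * x ^ k).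
  { intros k. apply Rmult_le_pos; [apply riccati_pos|apply pow_le; lra]. }
  apply Rle_trans with (sum_f_R0 (fun k => riccati 1 k * x ^ k) q).
  - now apply (sum_ge_last (fun k => riccati 1 k * x ^ k)).
  - apply sum_f_R0_le_more; [lia|exact P]. }
lra.
Qed.

Lemma CV_radius_bound (c : nat -> R) (r M : R) :
  (forall n, Rabs (c n * r ^ n) <= M) -> Rbar_le r (CV_radius c).
Proof. intros H. apply (proj1 (CV_radius_bounded c)). now exists M. Qed.

Lemma riccati_radius (x : R) : 0 <= x < PI -> Rbar_le x (CV_radius (riccati (-1))).
Proof.
intros Hx. apply CV_radius_bound with (tan (x / 2) / 2). intros n.
rewrite Rabs_mult, (Rabs_right (x ^ n)) by (apply Rle_ge, pow_le; lra).
eapply Rle_trans; [|apply riccati_tan; exact Hx].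
apply Rmult_le_compat_r; [apply pow_le; lra|apply riccati_bound].
Qed.

Lemma riccati_radius_2 (u : R) : Rabs u < 1 -> Rbar_lt (Rabs u) (CV_radius (riccati (-1))).
Proof.
intros Hu. apply Rbar_lt_le_trans with 1; [exact Hu|].
apply riccati_radius. generalize PI2_1. lra.
Qed.

Lemma PSeries_quarter (u : R) : PSeries quarter u = / 4.
Proof.
unfold PSeries. rewrite (Series_ext _ (fun n => / 4 * (0 ^ n))).
- rewrite Series_scal_l, Series_geom by (rewrite Rabs_R0; lra). field.
- intros [|n]; simpl; ring.
Qed.

Lemma riccati_ode (u : R) : Rabs u < 1 ->
  is_derive (PSeries (riccati (-1))) u (/ 4 - PSeries (riccati (-1)) u ^ 2).
Proof.
intros Hu. assert (C := riccati_radius_2 u Hu).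
evar_last; [now apply is_derive_PSeries|].
replace (PSeries (riccati (-1)) u ^ 2) with (PSeries (PS_mult (riccati (-1)) (riccati (-1))) u)
  by (rewrite PSeries_mult by exact C; ring).
rewrite <- (PSeries_quarter u). rewrite <- PSeries_minus.
- apply PSeries_ext. intros n. unfold PS_derive, PS_minus, PS_plus, PS_opp, PS_mult.
  rewrite riccati_S. unfold plus, opp; simpl plus; simpl opp.
  change (INR (S n) * ((quarter n + -1 * sum_f_R0 (fun i => riccati (-1) i * riccati (-1) (n - i)) n) / INR (S n)) =
    quarter n + - sum_f_R0 (fun k => riccati (-1) k * riccati (-1) (n - k)) n).
  field. apply not_0_INR. lia.
- apply CV_radius_inside. apply Rbar_lt_le_trans with 1; [exact Hu|].
  apply CV_radius_bound with 1. intros n. rewrite pow1, Rmult_1_r.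
  destruct n; simpl; [rewrite Rabs_right; lra|rewrite Rabs_R0; lra].
- now apply ex_pseries_mult.
Qed.

(* [e^u (1/2 - h) / (1/2 + h)] has zero derivative. *)
Lemma riccati_identity : locally 0 (fun u =>
  (/ 2 - PSeries (riccati (-1)) u) * (1 + exp u) = 1).
Proof.
set (h := PSeries (riccati (-1))).
assert (h0 : h 0 = 0) by (unfold h; rewrite PSeries_0; reflexivity).
assert (K : continuity_pt h 0).
{ apply PSeries_continuity, riccati_radius_2. rewrite Rabs_R0. lra. }
apply continuity_pt_filterlim in K.
destruct (K (fun y => Rabs y < / 4)) as [d Hd].
{ rewrite h0. exists (mkposreal (/ 4) ltac:(lra)). intros y Hy.
  change (Rabs (y - 0) < / 4) in Hy. now rewrite Rminus_0_r in Hy. }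
assert (Hd' : forall u, Rabs u < d -> Rabs (h u) < / 4).
{ intros u Hu. apply Hd. change (Rabs (u - 0) < d). now rewrite Rminus_0_r. }
set (q := fun u => exp u * (/ 2 - h u) / (/ 2 + h u)).
assert (Dq : forall u, Rabs u < d -> Rabs u < 1 -> is_derive q u 0).
{ intros u H1 H2. assert (N : / 2 + h u <> 0).
  { specialize (Hd' u H1). apply Rabs_lt_between in Hd'. lra. }
  assert (O := riccati_ode u H2). fold h in O.
  unfold q. evar_last.
  - apply (is_derive_div (fun u => exp u * (/ 2 - h u)) (fun u => / 2 + h u) u
      (exp u * (/ 2 - h u) + exp u * (- (/ 4 - h u ^ 2))) (/ 4 - h u ^ 2)).
    + apply (is_derive_mult exp (fun u => / 2 - h u)); [apply is_derive_exp| |intros; apply Rmult_comm].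
      evar_last; [apply (is_derive_minus (fun _ => / 2) h); [apply @is_derive_const|exact O]|].
      unfold minus, plus, opp, zero; simpl. as_R. ring.
    + evar_last; [apply (is_derive_plus (fun _ => / 2) h); [apply @is_derive_const|exact O]|].
      unfold plus, zero; simpl. as_R. ring.
    + exact N.
  - as_R. field. lra. }
assert (Hm : 0 < Rmin d 1) by (apply Rmin_pos; [apply cond_pos|lra]).
exists (mkposreal _ Hm). intros u Hu.
change (Rabs (u - 0) < Rmin d 1) in Hu. rewrite Rminus_0_r in Hu.
assert (Hu1 := Rlt_le_trans _ _ _ Hu (Rmin_l d 1)). assert (Hu2 := Rlt_le_trans _ _ _ Hu (Rmin_r d 1)).
assert (E : q u = 1).
{ assert (B : Rabs (q u - q 0) <= 0 * Rabs (u - 0)).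
  { apply (bounded_variation q (fun _ => 0)). intros t Ht. rewrite !Rminus_0_r in Ht. split.
    - apply Dq; lra.
    - rewrite Rabs_R0. lra. }
  rewrite Rmult_0_l in B. generalize (Rabs_pos (q u - q 0)). intros.
  assert (Z : Rabs (q u - q 0) = 0) by lra.
  assert (Z' : q u - q 0 = 0).
  { destruct (Req_dec (q u - q 0) 0) as [W|W]; [exact W|]. apply Rabs_no_R0 in W. lra. }
  assert (Q0 : q 0 = 1) by (unfold q; rewrite h0, exp_0; field). lra. }
unfold q in E. assert (N : / 2 + h u <> 0).
{ specialize (Hd' u Hu1). apply Rabs_lt_between in Hd'. lra. }
apply (f_equal (fun z => z * (/ 2 + h u))) in E.
unfold Rdiv in E. rewrite Rmult_assoc, Rinv_l, Rmult_1_r in E by exact N. lra.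
Qed.

(* Taylor coefficients of [1 / (1 + e^u)]. *)
Definition boole_coef (n : nat) : R := match n with O => / 2 | S _ => - riccati (-1) n end.

Definition kron0 (n : nat) : R := match n with O => 1 | S _ => 0 end.

Lemma PSeries_kron0 (u : R) : PSeries kron0 u = 1.
Proof.
unfold PSeries. rewrite (Series_ext _ (fun n => 0 ^ n)).
- rewrite Series_geom by (rewrite Rabs_R0; lra). field.
- intros [|n]; simpl; ring.
Qed.

Lemma kron0_radius (u : R) : Rabs u < 1 -> Rbar_lt (Rabs u) (CV_radius kron0).
Proof.
intros Hu. apply Rbar_lt_le_trans with 1; [exact Hu|].
apply CV_radius_bound with 1. intros n. rewrite pow1, Rmult_1_r.
destruct n; simpl; [rewrite Rabs_R1; lra|rewrite Rabs_R0; lra].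
Qed.

Lemma boole_coef_bound (x : R) : 0 < x < PI -> exists M, 0 < M /\
  forall n, Rabs (boole_coef n) <= M * (/ x) ^ n.
Proof.
intros Hx. exists (/ 2 + tan (x / 2) / 2).
assert (T : 0 <= tan (x / 2)).
{ left. apply tan_gt_0; lra. }
split; [lra|]. intros n. rewrite pow_inv.
apply Rle_div_r; [apply pow_lt; lra|].
destruct n as [|n].
- simpl. rewrite Rabs_right; lra.
- unfold boole_coef. rewrite Rabs_Ropp.
  apply Rle_trans with (riccati 1 (S n) * x ^ S n).
  + apply Rmult_le_compat_r; [apply pow_le; lra|apply riccati_bound].
  + generalize (riccati_tan (S n) x ltac:(lra)). lra.
Qed.

Lemma boole_coef_radius (u : R) : Rabs u < 1 -> Rbar_lt (Rabs u) (CV_radius boole_coef).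
Proof.
intros Hu. apply Rbar_lt_le_trans with 1; [exact Hu|].
destruct (boole_coef_bound 1) as [M [_ HM]]; [generalize PI2_1; lra|].
apply CV_radius_bound with M. intros n. rewrite pow1, Rmult_1_r.
generalize (HM n). rewrite Rinv_1, pow1. lra.
Qed.

(** Compare coefficients of u^n in B(u) (1 + e^u) = 1, where B is the series of [boole_coef]; the
    isolated term stems from the 1 beside e^u. *)
Lemma boole_coef_eq (n : nat) :
  boole_coef n + sum_f_R0 (fun i => boole_coef i / INR (fact (n - i))) n = kron0 n.
Proof.
set (b := PS_plus kron0 (fun n => / INR (fact n))).
assert (Ce : forall u, Rabs u < 1 -> Rbar_lt (Rabs u) (CV_radius (fun n => / INR (fact n)))).
{ intros u Hu. apply Rbar_lt_le_trans with 1; [exact Hu|].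
  apply CV_radius_bound with 1. intros k. rewrite pow1, Rmult_1_r, Rabs_right.
  - rewrite <- Rinv_1. apply Rinv_le_contravar; [lra|].
    generalize (le_INR _ _ (lt_O_fact k)). simpl. auto.
  - apply Rle_ge. left. apply Rinv_0_lt_compat, INR_fact_lt_0. }
assert (Cb : forall u, Rabs u < 1 -> Rbar_lt (Rabs u) (CV_radius b)).
{ intros u Hu. eapply Rbar_lt_le_trans; [|apply CV_radius_plus].
  apply Rbar_min_case; [now apply kron0_radius|now apply Ce]. }
assert (H0 : Rabs 0 < 1) by (rewrite Rabs_R0; lra).
assert (E : PS_mult boole_coef b n = kron0 n).
{ apply PSeries_ext_recip.
  - apply Rbar_lt_le_trans with (Rabs (/ 2)); [simpl; rewrite Rabs_right; lra|].
    apply CV_radius_pos, ex_pseries_mult; [apply boole_coef_radius|apply Cb]; rewrite Rabs_right; lra.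
  - generalize (kron0_radius 0 H0). now rewrite Rabs_R0.
  - generalize riccati_identity. intros [d Hd].
    assert (Hm : 0 < Rmin d 1) by (apply Rmin_pos; [apply cond_pos|lra]).
    exists (mkposreal _ Hm). intros u Hu.
    assert (Hd1 : ball 0 d u) by (apply ball_le with (2 := Hu); apply Rmin_l).
    assert (Hu1 : Rabs u < 1).
    { change (Rabs (u - 0) < Rmin d 1) in Hu. rewrite Rminus_0_r in Hu.
      eapply Rlt_le_trans; [exact Hu|apply Rmin_r]. }
    specialize (Hd u Hd1). rewrite PSeries_kron0, <- Hd.
    rewrite PSeries_mult by (auto using boole_coef_radius). f_equal.
    + rewrite (PSeries_ext boole_coef (PS_minus (PS_scal (/ 2) kron0) (riccati (-1)))).
      * rewrite PSeries_minus.
        -- rewrite PSeries_scal, PSeries_kron0. ring.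
        -- apply ex_pseries_scal; [intros; apply Rmult_comm|].
           now apply CV_radius_inside, kron0_radius.
        -- now apply CV_radius_inside, riccati_radius_2.
      * intros [|k].
        -- change (/ 2 = / 2 * 1 + - 0). ring.
        -- change (- riccati (-1) (S k) = / 2 * 0 + - riccati (-1) (S k)). ring.
    + unfold b. rewrite PSeries_plus.
      * rewrite PSeries_kron0, <- exp_Reals. reflexivity.
      * now apply CV_radius_inside, kron0_radius.
      * now apply CV_radius_inside, Ce. }
rewrite <- E. unfold PS_mult, b, PS_plus. symmetry.
rewrite (sum_eq _ (fun k => boole_coef k * kron0 (n - k) + boole_coef k / INR (fact (n - k)))).
- rewrite sum_plus. f_equal. destruct n as [|n]; [simpl; ring|].
  rewrite tech5, Nat.sub_diag. rewrite (sum_eq _ (fun _ => 0)), sum_eq_R0; [cbn [kron0]; ring|auto|].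
  intros i Hi. replace (S n - i)%nat with (S (n - i)) by lia. simpl. ring.
- intros i _. change (boole_coef i * (kron0 (n - i) + / INR (fact (n - i))) =
    boole_coef i * kron0 (n - i) + boole_coef i * / INR (fact (n - i))). ring.
Qed.

(** * Growth of the zeta values by Boole summation *)

Fixpoint falling (p : R) (i : nat) : R :=
  match i with O => 1 | S i => falling p i * (p - INR i) end.

Definition dpower (p : R) (i : nat) (t : R) : R := falling p i * Rpower t (p - INR i).

Lemma dpower_is_derive (p : R) (i : nat) (t : R) : 0 < t ->
  is_derive (dpower p i) t (dpower p (S i) t).
Proof.
intros Ht. unfold dpower.
apply (is_derive_ext (fun t => falling p i * Rpower t (p - INR i))); [reflexivity|].
evar_last.
- apply (is_derive_scal (fun t => Rpower t (p - INR i))). now apply is_derive_Rpower.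
- rewrite S_INR. replace (p - (INR i + 1)) with (p - INR i - 1) by ring. simpl. as_R. ring.
Qed.

Lemma dsum_dpower (p a : R) (i m : nat) : 0 < a -> p - INR i + 1 < INR m -> dsum m (dpower p i) a.
Proof.
intros Ha Hm. apply dsum_scal.
apply (dsum_ext m (pexp 1 0 (p - INR i) 0)).
- intros k. unfold pexp. rewrite Rmult_0_r, exp_0. simpl. ring.
- apply dsum_pexp; lra.
Qed.

(** Formally 1 = B(D) (1 + e^D) with D = d/dt and B(u) = 1 / (1 + e^u); this is the defect after
    cutting B at order N. By [asum_shift], each subtracted bracket sums to the boundary value
    [dpower p i a]. *)
Definition boole_rem (p : R) (N : nat) (t : R) : R :=
  dpower p 0 t + sum_f_R0 (fun i => (- boole_coef i) * (dpower p i t + dpower p i (t + 1))) N.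

(** The expansion of the i-th derivative stops at total order N, so that all remainders involve the
    same derivative, of order N + 1. *)
Lemma dpower_taylor (p : R) (N i : nat) (t X : R) : 0 < t -> (i <= N)%nat ->
  (forall v, t <= v <= t + 1 -> Rabs (dpower p (S N) v) <= X) ->
  Rabs (dpower p i (t + 1) - sum_f_R0 (fun l => dpower p (i + l) t / INR (fact l)) (N - i))
    <= X / INR (fact (S N - i)).
Proof.
intros Ht Hi HX.
generalize (taylor_bound (N - i) (fun l => dpower p (i + l)) t 1 X ltac:(lra)).
rewrite Nat.add_0_r. intros A.
replace (S N - i)%nat with (S (N - i)) by lia.
replace (X / INR (fact (S (N - i)))) with (X * 1 ^ S (N - i) / INR (fact (S (N - i))))
  by (rewrite pow1; field; apply INR_fact_neq_0).
rewrite (sum_eq _ (fun k => dpower p (i + k) t * 1 ^ k / INR (fact k))).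
- apply A.
  + intros n v Hv. rewrite Nat.add_succ_r. apply dpower_is_derive. lra.
  + intros v Hv. replace (i + S (N - i))%nat with (S N) by lia. now apply HX.
- intros l _. rewrite pow1. field. apply INR_fact_neq_0.
Qed.

Lemma sum_f_R0_opp (u : nat -> R) (N : nat) :
  sum_f_R0 (fun i => - u i) N = - sum_f_R0 u N.
Proof.
rewrite <- (Rmult_1_l (sum_f_R0 u N)), Ropp_mult_distr_l, scal_sum.
apply sum_eq. intros; ring.
Qed.

(* The choice of [boole_coef] cancels every derivative of order at most [N]. *)
Lemma boole_rem_eq (p : R) (N : nat) (t : R) :
  boole_rem p N t = - sum_f_R0 (fun i => boole_coef i *
     (dpower p i (t + 1) - sum_f_R0 (fun l => dpower p (i + l) t / INR (fact l)) (N - i))) N.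
Proof.
unfold boole_rem.
assert (E : sum_f_R0 (fun i => boole_coef i * dpower p i t) N +
   sum_f_R0 (fun i => boole_coef i * sum_f_R0 (fun l => dpower p (i + l) t / INR (fact l)) (N - i)) N
   = dpower p 0 t).
{ rewrite (sum_eq (fun i => boole_coef i * sum_f_R0 _ _)
     (fun i => sum_f_R0 (fun l => boole_coef i * (dpower p (i + l) t / INR (fact l))) (N - i))).
  2:{ intros i _. rewrite scal_sum. apply sum_eq. intros; ring. }
  rewrite (sum_triangle (fun i l => boole_coef i * (dpower p (i + l) t / INR (fact l)))).
  rewrite <- sum_plus.
  rewrite (sum_eq _ (fun q => kron0 q * dpower p q t)).
  - induction N as [|N IH]; [simpl; ring|]. rewrite tech5, IH. simpl. ring.
  - intros q _. rewrite <- boole_coef_eq, Rmult_plus_distr_r. f_equal.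
    rewrite (Rmult_comm (sum_f_R0 _ _)), scal_sum. apply sum_eq. intros i Hi.
    replace (i + (q - i))%nat with q by lia. unfold Rdiv. ring. }
rewrite <- E.
rewrite (sum_eq (fun i => - boole_coef i * _)
  (fun i => - (boole_coef i * dpower p i t) + - (boole_coef i * dpower p i (t + 1)))) by (intros; ring).
rewrite (sum_eq (fun i => boole_coef i * (_ - _))
  (fun i => boole_coef i * dpower p i (t + 1) -
     boole_coef i * sum_f_R0 (fun l => dpower p (i + l) t / INR (fact l)) (N - i))) by (intros; ring).
rewrite sum_plus, minus_sum.
rewrite !sum_f_R0_opp. ring.
Qed.

(** Each factor g + n - j with j < n is at most n - j in absolute value, because -2 <= g < 0 and n -
    j >= 1. The sharper g < -1 is the condition that makes t^g summable, which fixes the window for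
    g. *)
Lemma falling_bound (g : R) (n i : nat) : -2 <= g < -1 -> (i <= n)%nat ->
  Rabs (falling (g + INR n) i) <= INR (fact n) / INR (fact (n - i)).
Proof.
intros Hg. induction i as [|i IH]; intros Hi.
- simpl. rewrite Nat.sub_0_r, Rabs_R1. right. field. apply INR_fact_neq_0.
- simpl falling. rewrite Rabs_mult.
  replace (n - i)%nat with (S (n - S i)) in IH by lia.
  rewrite fact_simpl, mult_INR in IH.
  assert (H1 : INR (S (n - S i)) = INR n - INR i).
  { replace (S (n - S i)) with (n - i)%nat by lia. apply minus_INR. lia. }
  assert (H2 : 1 <= INR n - INR i).
  { rewrite <- H1. rewrite S_INR. generalize (pos_INR (n - S i)). lra. }
  assert (H3 : Rabs (g + INR n - INR i) <= INR (S (n - S i))).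
  { rewrite H1. apply Rabs_le. lra. }
  apply Rle_trans with (INR (fact n) / (INR (S (n - S i)) * INR (fact (n - S i))) * INR (S (n - S i))).
  + apply Rmult_le_compat; try apply Rabs_pos; [apply IH; lia|exact H3].
  + right. field. split; [apply INR_fact_neq_0|lra].
Qed.

Lemma sum_f_R0_rev (u : nat -> R) (N : nat) :
  sum_f_R0 (fun i => u (S N - i)%nat) N = sum_f_R0 (fun i => u (S i)) N.
Proof.
induction N as [|N IH]; [reflexivity|].
rewrite decomp_sum by lia. rewrite (tech5 (fun i => u (S i))), <- IH, Rplus_comm.
reflexivity.
Qed.

Lemma sum_pow_fact_rev (x : R) (N : nat) : 0 <= x ->
  sum_f_R0 (fun i => x ^ (S N - i) / INR (fact (S N - i))) N <= exp x.
Proof.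
intros Hx. rewrite (sum_f_R0_rev (fun k => x ^ k / INR (fact k))).
assert (P : forall k, 0 <= x ^ k / INR (fact k)).
{ intros k. apply Rdiv_le_0_compat; [now apply pow_le|apply INR_fact_lt_0]. }
apply Rle_trans with (sum_f_R0 (fun k => x ^ k / INR (fact k)) (S N)).
- rewrite (decomp_sum (fun k => x ^ k / INR (fact k))) by lia. simpl pred.
  generalize (P O). lra.
- apply is_series_incr_le; [|exact P].
  apply (is_series_ext (fun k => scal (pow_n x k) (/ INR (fact k)))).
  + intros k. rewrite pow_n_pow. reflexivity.
  + apply is_exp_Reals.
Qed.

(** Splitting (/ rho)^(N+1) into powers i and N + 1 - i leaves a piece of the series of e^(rho x).
    The case x = 1 serves the remainder, x = a the boundary terms. *)
Lemma boole_sum_bound (M rho x : R) (N : nat) (w : nat -> R) :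
  0 < rho -> 0 <= M -> 0 <= x -> (forall n, Rabs (boole_coef n) <= M * (/ rho) ^ n) ->
  (forall i, (i <= N)%nat -> Rabs (w i) <= INR (fact (S N)) / INR (fact (S N - i)) * x ^ (S N - i)) ->
  Rabs (sum_f_R0 (fun i => boole_coef i * w i) N) <=
    M * INR (fact (S N)) * (/ rho) ^ S N * exp (rho * x).
Proof.
intros Hr HM Hx HB Hw.
eapply Rle_trans; [apply Rsum_abs|].
apply Rle_trans with (M * INR (fact (S N)) * (/ rho) ^ S N *
   sum_f_R0 (fun i => (rho * x) ^ (S N - i) / INR (fact (S N - i))) N).
- rewrite scal_sum. apply sum_Rle. intros i Hi. rewrite Rabs_mult.
  eapply Rle_trans; [apply Rmult_le_compat; [apply Rabs_pos|apply Rabs_pos|apply HB|now apply Hw]|].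
  right.
  assert (E : (/ rho) ^ S N = (/ rho) ^ (S N - i) * (/ rho) ^ i) by (rewrite <- pow_add; f_equal; lia).
  rewrite E, Rpow_mult_distr, (pow_inv rho (S N - i)). field.
  repeat split; try apply INR_fact_neq_0; try apply pow_nonzero; lra.
- apply Rmult_le_compat_l.
  + apply Rmult_le_pos; [apply Rmult_le_pos; [exact HM|apply pos_INR]|].
    apply pow_le. left. now apply Rinv_0_lt_compat.
  + apply sum_pow_fact_rev. apply Rmult_le_pos; lra.
Qed.

Lemma boole_rem_bound (g M rho t : R) (N : nat) : -2 <= g < -1 -> 0 < rho -> 0 <= M -> 0 < t ->
  (forall n, Rabs (boole_coef n) <= M * (/ rho) ^ n) ->
  Rabs (boole_rem (g + INR (S N)) N t) <=
    M * INR (fact (S N)) * (/ rho) ^ S N * exp rho * Rpower t g.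
Proof.
intros Hg Hr HM Ht HB. set (p := g + INR (S N)).
assert (HX : forall v, t <= v <= t + 1 -> Rabs (dpower p (S N) v) <= INR (fact (S N)) * Rpower t g).
{ intros v Hv. unfold dpower. rewrite Rabs_mult, (Rabs_right (Rpower _ _)) by (left; apply Rpower_pos).
  replace (p - INR (S N)) with g by (unfold p; ring).
  apply Rmult_le_compat; [apply Rabs_pos|left; apply Rpower_pos| |].
  - generalize (falling_bound g (S N) (S N) Hg (le_n _)). fold p. rewrite Nat.sub_diag. simpl (fact 0).
    replace (INR 1) with 1 by reflexivity. rewrite Rdiv_1_r. auto.
  - apply Rpower_le_decr; lra. }
assert (HT := Rpower_pos t g).
rewrite boole_rem_eq, Rabs_Ropp.
set (R0 := fun i => dpower p i (t + 1) - sum_f_R0 (fun l => dpower p (i + l) t / INR (fact l)) (N - i)).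
rewrite (sum_eq _ (fun i => boole_coef i * (R0 i / Rpower t g) * Rpower t g)).
2:{ intros i _. fold (R0 i). field. lra. }
rewrite <- scal_sum, Rabs_mult, (Rabs_right (Rpower t g)) by lra.
rewrite (Rmult_comm (Rpower t g)). apply Rmult_le_compat_r; [lra|].
rewrite <- (Rmult_1_r rho) at 2.
apply boole_sum_bound; auto; [lra|].
intros i Hi. rewrite pow1, Rmult_1_r. unfold Rdiv. rewrite Rabs_mult, Rabs_inv, (Rabs_right (Rpower t g)) by lra.
apply Rle_div_l; [lra|].
eapply Rle_trans; [apply (dpower_taylor p N i t _ Ht Hi HX)|]. right. unfold Rdiv. ring.
Qed.

Definition zeta_real (a q : R) : R := alt_exp_reg 1 a q 0.

Lemma zeta_real_eq (a p : R) (m : nat) : 0 < a -> p + 1 < INR m ->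
  zeta_real a p = asum m (dpower p 0) a.
Proof.
intros Ha Hm. unfold zeta_real. rewrite (alt_exp_reg_eq 1 a p 0 m) by lra.
apply asum_ext. intros k. unfold pexp, dpower. rewrite Rmult_0_r, exp_0. simpl.
rewrite Rminus_0_r. ring.
Qed.

Lemma zeta_real_boole (a p : R) (N m : nat) : 0 < a -> p + 1 < INR m ->
  zeta_real a p = sum_f_R0 (fun i => boole_coef i * dpower p i a) N + asum m (boole_rem p N) a.
Proof.
intros Ha Hm.
assert (Hi : forall i, p - INR i + 1 < INR m) by (intros i; generalize (pos_INR i); lra).
assert (D : forall i, dsum m (dpower p i) a) by (intros; apply dsum_dpower; auto).
assert (D2 : forall i, dsum m (fun t => (- boole_coef i) * (dpower p i t + dpower p i (t + 1))) a).
{ intros i. apply dsum_scal, (dsum_plus m (dpower p i) (fun t => dpower p i (t + 1))); [apply D|].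
  apply dsum_shiftf, D. }
destruct (asum_sum m N _ a (fun i _ => D2 i)) as [D3 E3].
unfold boole_rem. rewrite (asum_plus m (dpower p 0)), E3 by auto.
rewrite <- zeta_real_eq by auto.
rewrite (sum_eq (fun j => asum m _ a) (fun i => - (boole_coef i * dpower p i a))).
- rewrite (sum_f_R0_opp (fun i => boole_coef i * dpower p i a)). ring.
- intros i _. rewrite asum_scal.
  rewrite (asum_plus m (dpower p i) (fun t => dpower p i (t + 1))), asum_shiftf, asum_shift by
    (auto; now apply dsum_shiftf). ring.
Qed.

(** [rho] is quantified inside so that a polynomial loss in n can be paid for by moving to a larger
    radius still below PI. *)
Definition zeta_growth (a g : R) : Prop := forall rho, 0 < rho < PI ->
  exists M, 0 <= M /\ forall n, Rabs (zeta_real a (g + INR n)) <= M * INR (fact n) * (/ rho) ^ n.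

Lemma zeta_growth_base (a g : R) : 0 < a -> -2 <= g < -1 -> zeta_growth a g.
Proof.
intros Ha Hg rho Hr. destruct (boole_coef_bound rho Hr) as [M [HM HB]].
set (T := Series (fun k => Rpower (INR k + a) g)).
assert (ET : ex_series (fun k => Rpower (INR k + a) g)) by (apply ex_series_Rpower; lra).
assert (HT : 0 <= T).
{ unfold T. rewrite <- (Rmult_0_l (Series (fun _ => 0))), <- Series_scal_l.
  apply Series_le; [|exact ET]. intros k. rewrite Rmult_0_l. split; [lra|left; apply Rpower_pos]. }
assert (Hag := Rpower_pos a g).
set (C := M * (Rpower a g * exp (rho * a)) + M * exp rho * T).
assert (HC : 0 <= C).
{ unfold C. generalize (exp_pos (rho * a)) (exp_pos rho). intros.
  apply Rplus_le_le_0_compat; repeat apply Rmult_le_pos; lra. }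
exists (C + Rabs (zeta_real a (g + INR 0))).
generalize (Rabs_pos (zeta_real a (g + INR 0))). intros HZ. split; [lra|].
intros [|N]; [simpl; lra|].
(* Truncating at order N leaves the exponent p - (N + 1) = g in the remainder, whose sum then
   converges absolutely without Euler steps. *)
set (p := g + INR (S N)).
destruct (nfloor_ex (Rabs p + 1)) as [m [_ Hm]]; [generalize (Rabs_pos p); lra|].
rewrite <- S_INR in Hm.
rewrite (zeta_real_boole a p N (S m)) by (auto; generalize (Rle_abs p); lra).
set (F := INR (fact (S N)) * (/ rho) ^ S N).
assert (HF : 0 <= F).
{ unfold F. apply Rmult_le_pos; [apply pos_INR|apply pow_le; left; apply Rinv_0_lt_compat; lra]. }
assert (B1 : Rabs (sum_f_R0 (fun i => boole_coef i * dpower p i a) N) <=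
   M * (Rpower a g * exp (rho * a)) * F).
{ rewrite (sum_eq _ (fun i => boole_coef i * (dpower p i a / Rpower a g) * Rpower a g)).
  2:{ intros i _. field. lra. }
  rewrite <- scal_sum, Rabs_mult, (Rabs_right (Rpower a g)) by lra.
  replace (M * _ * F) with (Rpower a g * (M * INR (fact (S N)) * (/ rho) ^ S N * exp (rho * a)))
    by (unfold F; ring).
  apply Rmult_le_compat_l; [lra|].
  apply boole_sum_bound; auto; try lra.
  intros i Hi. unfold dpower.
  replace (falling p i * Rpower a (p - INR i) / Rpower a g) with (falling p i * a ^ (S N - i)).
  - rewrite Rabs_mult, (Rabs_right (a ^ _)) by (apply Rle_ge, pow_le; lra).
    apply Rmult_le_compat_r; [apply pow_le; lra|]. apply falling_bound; [exact Hg|lia].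
  - rewrite <- Rpower_pow by exact Ha. rewrite minus_INR by lia.
    replace (p - INR i) with (INR (S N) - INR i + g) by (unfold p; ring).
    rewrite Rpower_plus. field. lra. }
assert (HR : forall k, Rabs (boole_rem p N (INR k + a)) <= M * exp rho * F * Rpower (INR k + a) g).
{ intros k. eapply Rle_trans; [apply boole_rem_bound with (M := M) (rho := rho); auto using INR_plus_pos; lra|].
  right. unfold F. ring. }
assert (D : dsum 0 (boole_rem p N) a).
{ apply dsum_of_bound with (fun t => M * exp rho * F * Rpower t g); [exact HR|].
  now apply ex_series_scal_R. }
rewrite (asum_le_eq 0 (S m)) by (auto; lia).
assert (B2 : Rabs (asum 0 (boole_rem p N) a) <= M * exp rho * T * F).
{ replace (M * exp rho * T * F) with
    (asum_bound 0 (fun _ t => M * exp rho * F * Rpower t g) a).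
  - apply asum_abs_le.
    + intros i k Hi. replace i with O by lia. apply HR.
    + now apply ex_series_scal_R.
  - simpl. rewrite Series_scal_l. fold T. ring. }
eapply Rle_trans; [apply Rabs_triang|].
rewrite Rmult_assoc. fold F.
apply Rle_trans with (C * F); [unfold C; lra|]. apply Rmult_le_compat_r; lra.
Qed.

(** Shifting n to n + 1 costs a factor n + 1, which Bernoulli's inequality absorbs in (r1 / rho)^n
    for an r1 between rho and PI. *)
Lemma zeta_growth_up (a g : R) : zeta_growth a g -> zeta_growth a (g + 1).
Proof.
intros H rho Hr. set (r1 := (rho + PI) / 2).
destruct (H r1) as [M [HM HB]]; [unfold r1; lra|].
set (x := r1 / rho - 1).
assert (Hx : 0 < x).
{ assert (1 < r1 / rho) by (apply Rlt_div_r; unfold r1; lra). unfold x. lra. }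
exists (M * / r1 * (1 + / x)).
assert (Hr1 : 0 < / r1) by (apply Rinv_0_lt_compat; unfold r1; lra).
assert (Hix : 0 < / x) by now apply Rinv_0_lt_compat.
split; [repeat apply Rmult_le_pos; lra|].
intros n. replace (g + 1 + INR n) with (g + INR (S n)) by (rewrite S_INR; ring).
eapply Rle_trans; [apply HB|].
assert (Bn : INR (S n) * (/ r1) ^ n <= (1 + / x) * (/ rho) ^ n).
{ assert (P := poly n x Hx).
  assert (Q : (1 + x) ^ n * (/ r1) ^ n = (/ rho) ^ n).
  { rewrite <- Rpow_mult_distr. f_equal. unfold x, r1. field. lra. }
  rewrite <- Q. rewrite <- Rmult_assoc. apply Rmult_le_compat_r; [apply pow_le; lra|].
  rewrite S_INR. apply Rle_trans with ((1 + / x) * (1 + INR n * x)).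
  - replace ((1 + / x) * (1 + INR n * x)) with (INR n + 1 + (/ x + INR n * x)) by (field; lra).
    assert (0 <= INR n * x) by (apply Rmult_le_pos; [apply pos_INR|lra]). lra.
  - apply Rmult_le_compat_l; lra. }
rewrite fact_simpl, mult_INR. simpl ((/ r1) ^ S n).
replace (M * _ * _) with (M * / r1 * INR (fact n) * (INR (S n) * (/ r1) ^ n)) by ring.
replace (M * / r1 * _ * _ * _) with (M * / r1 * INR (fact n) * ((1 + / x) * (/ rho) ^ n)) by ring.
apply Rmult_le_compat_l; [|exact Bn].
repeat apply Rmult_le_pos; try lra. apply pos_INR.
Qed.

Lemma zeta_growth_down (a g : R) : zeta_growth a g -> zeta_growth a (g - 1).
Proof.
intros H rho Hr. destruct (H rho Hr) as [M [HM HB]].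
assert (HZ := Rabs_pos (zeta_real a (g - 1 + INR 0))).
exists (M * rho + Rabs (zeta_real a (g - 1 + INR 0))).
assert (0 <= M * rho) by (apply Rmult_le_pos; lra). split; [lra|].
intros [|n]; [simpl; lra|].
replace (g - 1 + INR (S n)) with (g + INR n) by (rewrite S_INR; ring).
eapply Rle_trans; [apply HB|].
assert (P : 0 < (/ rho) ^ n) by (apply pow_lt, Rinv_0_lt_compat; lra).
apply Rle_trans with ((M * rho) * INR (fact (S n)) * (/ rho) ^ S n).
- simpl ((/ rho) ^ S n). replace (M * rho * INR (fact (S n)) * (/ rho * (/ rho) ^ n)) with
    (M * INR (fact (S n)) * (/ rho) ^ n) by (field; lra).
  apply Rmult_le_compat_r; [lra|]. apply Rmult_le_compat_l; [exact HM|].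
  apply le_INR, fact_le. lia.
- apply Rmult_le_compat_r; [apply pow_le; left; apply Rinv_0_lt_compat; lra|].
  apply Rmult_le_compat_r; [apply pos_INR|lra].
Qed.

Lemma zeta_growth_all (a g : R) : 0 < a -> zeta_growth a g.
Proof.
intros Ha.
assert (U : forall n g, zeta_growth a g -> zeta_growth a (g + INR n)).
{ induction n as [|n IH]; intros g0 H; [simpl; now rewrite Rplus_0_r|].
  replace (g0 + INR (S n)) with (g0 + INR n + 1) by (rewrite S_INR; ring).
  now apply zeta_growth_up, IH. }
assert (D : forall n g, zeta_growth a g -> zeta_growth a (g - INR n)).
{ induction n as [|n IH]; intros g0 H; [simpl; now rewrite Rminus_0_r|].
  replace (g0 - INR (S n)) with (g0 - INR n - 1) by (rewrite S_INR; ring).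
  now apply zeta_growth_down, IH. }
destruct (Rle_or_lt 0 (g + 2)) as [H|H].
- destruct (nfloor_ex (g + 2) H) as [n Hn].
  replace g with (g - INR n + INR n) by ring. apply U, zeta_growth_base; [exact Ha|lra].
- destruct (nfloor_ex (- (g + 2))) as [n Hn]; [lra|].
  replace g with (g + INR (S n) - INR (S n)) by ring.
  (* g + n + 1 lies in (-2, -1]; at the excluded end -1 the base case is taken at -2 and raised
     once. *)
  destruct (Rlt_le_dec (g + INR (S n)) (-1)) as [L|L].
  + apply D, zeta_growth_base; [exact Ha|]. rewrite S_INR in *. lra.
  + rewrite S_INR in L. replace (g + INR (S n)) with (g + INR n + 1) by (rewrite S_INR; ring).
    apply D, zeta_growth_up, zeta_growth_base; [exact Ha|]. lra.
Qed.

(** * Equality on (0, PI) for alpha = 1 *)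

Definition zeta_series (a g : R) (k : nat) : R :=
  (-1) ^ k / INR (fact k) * zeta_real a (g + INR k).

Lemma zeta_series_radius (a g y : R) : 0 < a -> Rabs y < PI ->
  Rbar_lt (Rabs y) (CV_radius (zeta_series a g)).
Proof.
intros Ha Hy. set (rho := (Rabs y + PI) / 2). assert (HR := Rabs_pos y).
destruct (zeta_growth_all a g Ha rho) as [M [HM HB]]; [unfold rho; lra|].
apply Rbar_lt_le_trans with rho; [simpl; unfold rho; lra|].
apply CV_radius_bound with M. intros n. unfold zeta_series.
assert (Hr : 0 < rho ^ n) by (apply pow_lt; unfold rho; lra).
unfold Rdiv. rewrite !Rabs_mult, Rabs_pow_m1, Rabs_inv, (Rabs_right (INR _)), (Rabs_right (rho ^ n));
  [|lra|left; apply INR_fact_lt_0].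
rewrite Rmult_1_l. specialize (HB n). rewrite pow_inv in HB.
apply Rle_trans with (/ INR (fact n) * (M * INR (fact n) * / rho ^ n) * rho ^ n).
- apply Rmult_le_compat_r; [lra|]. apply Rmult_le_compat_l; [|exact HB].
  left. apply Rinv_0_lt_compat, INR_fact_lt_0.
- right. field. split; [lra|apply INR_fact_neq_0].
Qed.

Lemma zeta_series_is_derive (a g y : R) : 0 < a -> Rabs y < PI ->
  is_derive (PSeries (zeta_series a g)) y (- PSeries (zeta_series a (g + 1)) y).
Proof.
intros Ha Hy. evar_last; [now apply is_derive_PSeries, zeta_series_radius|].
as_R. rewrite (PSeries_ext _ (PS_scal (-1) (zeta_series a (g + 1)))).
- rewrite PSeries_scal. ring.
- intros k. unfold PS_derive, PS_scal, zeta_series.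
  replace (g + INR (S k)) with (g + 1 + INR k) by (rewrite S_INR; ring).
  rewrite fact_simpl, mult_INR.
  change (INR (S k) * ((-1) ^ S k / (INR (S k) * INR (fact k)) * zeta_real a (g + 1 + INR k)) =
    (-1) * ((-1) ^ k / INR (fact k) * zeta_real a (g + 1 + INR k))).
  simpl pow. field. split; [apply INR_fact_neq_0|apply not_0_INR; lia].
Qed.

(** One term of the binomial expansion of (1 + e)^(n+k) is at most the whole. *)
Lemma fact_ratio_le (e : R) (n k : nat) : 0 < e ->
  INR (fact (n + k)) / INR (fact k) <= INR (fact n) * ((1 + e) / e) ^ n * (1 + e) ^ k.
Proof.
intros He.
assert (B := binomial e 1 (n + k)).
set (u := fun i => Binomial.C (n + k) i * e ^ i * 1 ^ (n + k - i)) in B.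
assert (P : forall i, 0 <= u i).
{ intros i. unfold u, Binomial.C. rewrite pow1, Rmult_1_r.
  apply Rmult_le_pos; [|apply pow_le; lra].
  apply Rdiv_le_0_compat; [apply pos_INR|]. apply Rmult_lt_0_compat; apply INR_fact_lt_0. }
assert (L : u n <= (e + 1) ^ (n + k)).
{ rewrite B. apply Rle_trans with (sum_f_R0 u n).
  - now apply sum_ge_last.
  - apply sum_f_R0_le_more; [lia|exact P]. }
unfold u, Binomial.C in L. replace (n + k - n)%nat with k in L by lia.
rewrite pow1, Rmult_1_r, (Rplus_comm e 1), pow_add in L.
assert (He' : 0 < e ^ n) by now apply pow_lt.
unfold Rdiv at 2. rewrite Rpow_mult_distr, pow_inv.
apply Rle_trans with (INR (fact n) * / e ^ n *
  (INR (fact (n + k)) / (INR (fact n) * INR (fact k)) * e ^ n)).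
- right. field. repeat split; try apply INR_fact_neq_0. lra.
- replace (INR (fact n) * ((1 + e) ^ n * / e ^ n) * (1 + e) ^ k) with
   (INR (fact n) * / e ^ n * ((1 + e) ^ n * (1 + e) ^ k)) by ring.
  apply Rmult_le_compat_l; [|exact L].
  apply Rmult_le_pos; [apply pos_INR|left; now apply Rinv_0_lt_compat].
Qed.

(** A real substitute for Cauchy's estimates: n-th derivatives grow at most like n! W^n on [0, b]. W
    precedes g in the quantifiers, so one step length will do for all exponents. *)
Lemma zeta_series_bound (a b : R) : 0 < a -> 0 < b < PI -> exists W, 0 < W /\
  forall g, exists M, 0 <= M /\ forall n y, 0 <= y <= b ->
    Rabs (PSeries (zeta_series a (g + INR n)) y) <= M * (INR (fact n) * W ^ n).
Proof.
intros Ha Hb. set (rho := (b + PI) / 2). assert (Hr : b < rho < PI) by (unfold rho; lra).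
(* This e makes (1 + e) b the midpoint of b and rho, so the ratio q = (1 + e) b / rho is below 1. *)
set (e := (rho - b) / (2 * b)).
assert (He : 0 < e) by (apply Rdiv_lt_0_compat; lra).
set (q := (rho + b) / (2 * rho)).
assert (Hq : 0 <= q < 1).
{ unfold q. split; [apply Rdiv_le_0_compat; lra|apply Rlt_div_l; lra]. }
assert (Eq : (1 + e) * b / rho = q) by (unfold e, q; field; lra).
exists ((1 + e) / e / rho). split.
{ repeat apply Rdiv_lt_0_compat; lra. }
intros g. destruct (zeta_growth_all a g Ha rho) as [M [HM HB]]; [lra|].
exists (M / (1 - q)). split; [apply Rdiv_le_0_compat; lra|].
intros n y Hy. set (W := (1 + e) / e / rho).
assert (HW : 0 < W) by (unfold W; repeat apply Rdiv_lt_0_compat; lra).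
assert (T : forall k, Rabs (zeta_series a (g + INR n) k * y ^ k) <= M * (INR (fact n) * W ^ n) * q ^ k).
{ intros k. unfold zeta_series.
  replace (g + INR n + INR k) with (g + INR (n + k)) by (rewrite plus_INR; ring).
  unfold Rdiv. rewrite !Rabs_mult, Rabs_pow_m1, Rabs_inv, (Rabs_right (INR _)), (Rabs_right (y ^ k));
    [|apply Rle_ge, pow_le; lra|left; apply INR_fact_lt_0].
  rewrite Rmult_1_l.
  apply Rle_trans with (/ INR (fact k) * (M * INR (fact (n + k)) * (/ rho) ^ (n + k)) * b ^ k).
  - apply Rmult_le_compat; [| | |apply pow_incr; lra].
    + apply Rmult_le_pos; [left; apply Rinv_0_lt_compat, INR_fact_lt_0|apply Rabs_pos].
    + apply pow_le; lra.
    + apply Rmult_le_compat_l; [left; apply Rinv_0_lt_compat, INR_fact_lt_0|apply HB].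
  - apply Rle_trans with (M * ((/ rho) ^ (n + k) * b ^ k) *
      (INR (fact n) * ((1 + e) / e) ^ n * (1 + e) ^ k)).
    + replace (/ INR (fact k) * _ * _) with
       (M * ((/ rho) ^ (n + k) * b ^ k) * (INR (fact (n + k)) / INR (fact k))) by (unfold Rdiv; ring).
      apply Rmult_le_compat_l; [|now apply fact_ratio_le].
      apply Rmult_le_pos; [exact HM|]. apply Rmult_le_pos; apply pow_le; [|lra].
      left. apply Rinv_0_lt_compat. lra.
    + right. rewrite <- Eq. unfold W, Rdiv. rewrite pow_add, !Rpow_mult_distr. ring. }
unfold PSeries.
assert (Eg : ex_series (fun k => M * (INR (fact n) * W ^ n) * q ^ k)).
{ apply ex_series_scal_R, ex_series_geom. rewrite Rabs_right; lra. }
eapply Rle_trans; [apply Series_Rabs|].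
- apply ex_series_le_R with (2 := Eg). intros k. rewrite Rabs_Rabsolu. apply T.
- eapply Rle_trans; [apply Series_le; [|exact Eg]|].
  + intros k. split; [apply Rabs_pos|apply T].
  + rewrite Series_scal_l, Series_geom by (rewrite Rabs_right; lra). right. field. lra.
Qed.

Lemma zeta_series_taylor (a b : R) : 0 < a -> 0 < b < PI -> exists r, 0 < r /\
  forall g x0 h, 0 <= x0 -> 0 <= h <= r -> x0 + h <= b ->
  is_series (fun k => (- h) ^ k / INR (fact k) * PSeries (zeta_series a (g + INR k)) x0)
    (PSeries (zeta_series a g) (x0 + h)).
Proof.
intros Ha Hb. destruct (zeta_series_bound a b Ha Hb) as [W [HW HB]].
(* The n! of the derivative bound cancels that of Taylor's formula, leaving the ratio W h <= 1/2. *)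
exists (/ (2 * W)). split; [apply Rinv_0_lt_compat; lra|].
intros g x0 h Hx0 Hh Hxh. destruct (HB g) as [M [HM HMb]].
set (H := fun n y => (-1) ^ n * PSeries (zeta_series a (g + INR n)) y).
assert (HWh : 0 <= W * h <= / 2).
{ split; [apply Rmult_le_pos; lra|].
  apply Rle_trans with (W * / (2 * W)); [apply Rmult_le_compat_l; lra|]. right. field. lra. }
apply is_series_of_error with (fun N => (M * / 2) * (/ 2) ^ N).
- intros N.
  generalize (taylor_bound N H x0 h (M * (INR (fact (S N)) * W ^ S N)) (proj1 Hh)).
  intros A. eapply Rle_trans; [|eapply Rle_trans; [apply A|]].
  + right.
    rewrite (sum_eq _ (fun k => H k x0 * h ^ k / INR (fact k))).
    * f_equal. unfold H at 2. simpl. rewrite Rplus_0_r. ring.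
    * intros k _. unfold H.
      replace (- h) with (-1 * h) by ring. rewrite Rpow_mult_distr. unfold Rdiv. ring.
  + intros n v Hv. unfold H. simpl pow. rewrite (Rmult_comm (-1)), Rmult_assoc.
    apply (is_derive_scal (PSeries (zeta_series a (g + INR n)))).
    evar_last; [apply zeta_series_is_derive; [exact Ha|rewrite Rabs_right; lra]|].
    rewrite S_INR, <- Rplus_assoc. as_R. ring.
  + intros v Hv. unfold H. rewrite Rabs_mult, Rabs_pow_m1, Rmult_1_l. apply HMb. lra.
  + apply Rle_trans with (M * (W * h) ^ S N).
    * right. rewrite Rpow_mult_distr. field. apply INR_fact_neq_0.
    * rewrite Rmult_assoc. apply Rmult_le_compat_l; [exact HM|].
      change (/ 2 * (/ 2) ^ N) with ((/ 2) ^ S N). apply pow_incr. lra.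
- apply is_lim_seq_geom_scal. lra.
Qed.

(* Both sides have the same Taylor expansion of uniformly bounded radius. *)
Lemma alt_exp_reg_zeta_series (a g b : R) : 0 < a -> 0 < b < PI ->
  alt_exp_reg 1 a g b = PSeries (zeta_series a g) b.
Proof.
intros Ha Hb. destruct (zeta_series_taylor a b Ha Hb) as [r1 [Hr1 T]].
set (r := Rmin r1 (/ (2 * crude_rate))). generalize crude_rate_pos. intros Hc.
assert (Hr : 0 < r) by (apply Rmin_pos; [exact Hr1|apply Rinv_0_lt_compat; lra]).
(* All exponents at once: the Taylor coefficients at x0 = j r for one exponent are the values there
   for that exponent plus k, which the induction hypothesis supplies. *)
assert (P : forall j g x, 0 <= x <= b -> x <= INR j * r ->
   alt_exp_reg 1 a g x = PSeries (zeta_series a g) x).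
{ induction j as [|j IH]; intros g' x Hx Hxj.
  - simpl in Hxj. replace x with 0 by lra. rewrite PSeries_0. unfold zeta_series, zeta_real.
    simpl. rewrite Rplus_0_r. field.
  - destruct (Rle_or_lt x (INR j * r)) as [L|L]; [now apply IH|].
    set (x0 := INR j * r) in *. set (h := x - x0).
    assert (Hx0 : 0 <= x0) by (apply Rmult_le_pos; [apply pos_INR|lra]).
    assert (Hh : 0 <= h <= r) by (unfold h; rewrite S_INR in Hxj; unfold x0 in *; lra).
    replace x with (x0 + h) by (unfold h; ring).
    assert (S1 := T g' x0 h Hx0 (conj (proj1 Hh) (Rle_trans _ _ _ (proj2 Hh) (Rmin_l _ _)))
      ltac:(unfold h; lra)).
    assert (S2 := alt_exp_reg_series 1 a g' x0 h ltac:(lra) Ha Hx0 (proj1 Hh)).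
    rewrite <- (is_series_unique _ _ S1). symmetry. apply is_series_unique.
    eapply is_series_ext; [|apply S2].
    + intros k. simpl. rewrite Rmult_1_l. f_equal. apply IH; [unfold h in Hh; lra|].
      apply Rle_refl.
    + right. apply Rle_trans with (crude_rate * / (2 * crude_rate)).
      * apply Rmult_le_compat_l; [lra|]. eapply Rle_trans; [apply Hh|apply Rmin_r].
      * right. field. lra. }
destruct (nfloor_ex (b / r)) as [n [_ Hn]]; [apply Rdiv_le_0_compat; lra|].
apply (P (S n)); [lra|]. rewrite S_INR. apply Rlt_div_l in Hn; lra.
Qed.

Lemma is_series_RtoC (u : nat -> R) (l : R) : is_series u l ->
  is_series (K := C_AbsRing) (V := C_NormedModule) (fun k => RtoC (u k)) (RtoC l).
Proof.
intros H. apply is_series_C; [exact H|].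
change (is_series (fun _ : nat => 0) 0).
apply is_series_of_error with (fun _ => 0); [|apply is_lim_seq_const].
intros N. rewrite sum_eq_R0, Rminus_0_r, Rabs_R0 by auto. lra.
Qed.

Theorem theorem1p2 (a gamma alpha : R) (ha : 0 < a) (halpha : 0 < alpha) :
  asymptotic_expansion_0r
    (fun x : R => RtoC (alt_exp_sum a gamma alpha x)) (zeta_coef a gamma alpha)
  /\ (alpha < 1 ->
      forall x : R, 0 < x ->
        is_series (K := C_AbsRing) (V := C_NormedModule)
          (fun k : nat => (zeta_coef a gamma alpha k * RtoC (x ^ k))%C)
          (RtoC (alt_exp_sum a gamma alpha x)))
  /\ (alpha = 1 ->
      forall x : R, 0 < x < PI ->
        is_series (K := C_AbsRing) (V := C_NormedModule)
          (fun k : nat => (zeta_coef a gamma alpha k * RtoC (x ^ k))%C)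
          (RtoC (alt_exp_sum a gamma alpha x))).
Proof.
assert (E : forall x, is_series (fun k => (- x) ^ k / INR (fact k) * alt_exp_reg alpha a (gamma + alpha * INR k) 0)
    (alt_exp_sum a gamma alpha x) -> is_series (K := C_AbsRing) (V := C_NormedModule)
          (fun k : nat => (zeta_coef a gamma alpha k * RtoC (x ^ k))%C)
          (RtoC (alt_exp_sum a gamma alpha x))).
{ intros x H. eapply is_series_ext; [|apply is_series_RtoC, H].
  intros k. symmetry. now apply zeta_coef_pow. }
split; [now apply alt_exp_sum_asymptotic|]. split.
- intros H1 x Hx. apply E. rewrite <- alt_exp_reg_pos by assumption.
  replace (alt_exp_reg alpha a gamma x) with (alt_exp_reg alpha a gamma (0 + x))
    by (now rewrite Rplus_0_l).
  apply alt_exp_reg_series; auto; lra.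
- intros -> x Hx. apply E. rewrite <- alt_exp_reg_pos by lra.
  rewrite alt_exp_reg_zeta_series by auto.
  assert (C : ex_pseries (zeta_series a gamma) x).
  { apply CV_radius_inside, zeta_series_radius; [exact ha|rewrite Rabs_right; lra]. }
  apply PSeries_correct in C. revert C. apply is_series_ext. intros k.
  rewrite pow_n_pow, Rmult_1_l.
  change (x ^ k * zeta_series a gamma k =
    (- x) ^ k / INR (fact k) * alt_exp_reg 1 a (gamma + INR k) 0).
  unfold zeta_series, zeta_real. replace (- x) with (-1 * x) by ring.
  rewrite Rpow_mult_distr. unfold Rdiv. ring.
Qed.
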